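(* Let $M={}_{f_2}M_1\times_{f_1}M_2$ with metric $g$ be a doubly warped product manifold, $m_i=\dim M_i$, $m=m_1+m_2$, $k=\ln f_1$, $l=\ln f_2$. If $(M,g,\psi)$ is a gradient Riemann soliton with constant $\lambda$, then the following statements hold: (a) $(\nabla^1\varphi_1,\lambda_1,\mu_1)$ defines a gradient almost $\eta$-Ricci soliton on $(M_1,g_1)$, where $\varphi_1=(m-2)\psi_1-m_2k$, $\lambda_1=f_2^2\big((m-1)\lambda+\Delta l-\Delta\psi-(m-2)g(\nabla l,\nabla\psi)\big)$, $\psi_1=\psi|_{M_1}$, $\eta=dk$ and $\mu_1=m_2$; (b) $(\nabla^2\varphi_2,\lambda_2,\mu_2)$ defines a gradient almost $\eta$-Ricci soliton on $(M_2,g_2)$, where $\varphi_2=(m-2)\psi_2-m_1l$, $\lambda_2=f_1^2\big((m-1)\lambda+\Delta k-\Delta\psi-(m-2)g(\nabla k,\nabla\psi)\big)$, $\psi_2=\psi|_{M_2}$, $\eta=dl$ and $\mu_2=m_1$.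
   Context: Let $(M_1,g_1)$ and $(M_2,g_2)$ be Riemannian manifolds, let $f_1$ and $f_2$ be positive smooth functions on $M_1$ and $M_2$ respectively, and let $\pi_i:M_1\times M_2\to M_i$ be the canonical projections. The doubly warped product manifold ${}_{f_2}M_1\times_{f_1}M_2$ is $M_1\times M_2$ equipped with the metric $g=(f_2\circ\pi_2)^2\pi_1^*(g_1)+(f_1\circ\pi_1)^2\pi_2^*(g_2)$. The symbols $k,l$ also denote the pullbacks $k\circ\pi_1$, $l\circ\pi_2$ to $M$ (and likewise for $f_1,f_2$). $\nabla$ (gradient, connection) and $\Delta$ (trace of the Hessian) are those of $(M,g)$; $\nabla^i$ is the gradient (connection) of $(M_i,g_i)$. Functions on $M$ appearing in a statement about $M_1$ (in particular $\psi_1=\psi|_{M_1}$ and $\lambda_1$) are restricted to the slices $M_1\times\{p_2\}$, $p_2\in M_2$, each identified with $M_1$; similarly for $M_2$ and the slices $\{p_1\}\times M_2$, $p_1\in M_1$. $(M,g,\psi)$, with $\psi$ a smooth function on $M$, is a gradient Riemann soliton with real constant $\lambda$ if $h^\psi\wedge g+R=\lambda G$, where $h^\psi$ is the Hessian tensor of $\psi$, $R$ the Riemann curvature tensor, $\wedge$ the Kulkarni-Nomizu product and $G=\frac12(g\wedge g)$; explicitly, for all vector fields $X,Y,Z,W$, $$R(X,Y,Z,W)+g(X,W)h^\psi(Y,Z)+g(Y,Z)h^\psi(X,W)-g(X,Z)h^\psi(Y,W)-g(Y,W)h^\psi(X,Z)=\lambda\big(g(X,W)g(Y,Z)-g(X,Z)g(Y,W)\big),$$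 with the sign convention for $R$ such that contraction of $R(X,Y,Z,W)$ over $X$ and $W$ gives the Ricci tensor $\mathrm{Ric}(Y,Z)$. For $i\in\{1,2\}$, $(\nabla^i\varphi_i,\lambda_i,\mu_i)$ defines a gradient almost $\eta$-Ricci soliton on $(M_i,g_i)$, with $\eta$ a $1$-form on $M_i$, if ${}^i\mathrm{Ric}+h_i^{\varphi_i}=\lambda_ig_i+\mu_i\,\eta\otimes\eta$, where ${}^i\mathrm{Ric}$ is the Ricci tensor and $h_i^{\varphi_i}$ the Hessian of $\varphi_i$ on $(M_i,g_i)$. *)

(* Defs.v *)
From mathcomp Require Import all_boot all_order all_algebra.
From mathcomp Require Import all_classical all_reals all_analysis.

Set Implicit Arguments.
Unset Strict Implicit.
Unset Printing Implicit Defensive.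

Import Order.TTheory GRing.Theory Num.Theory.
Import numFieldNormedType.Exports.

Local Open Scope classical_set_scope.
Local Open Scope ring_scope.

(* A smooth n-manifold is given by an atlas of charts (coord i, param i)      *)
(* together with a choice chart_at p of a chart around each point p (the      *)
(* choice is arbitrary: it is a field of the structure). The tangent space    *)
(* T_pM is identified with the row vectors 'rV[R]_n through the coordinate    *)
(* frame of chart_at p, so a vector or tensor at p is given by its components *)
(* in that frame. All tensors below (metric, differential, gradient, Hessian, *)
(* curvature) are computed at p in the chart chart_at p by the classical      *)
(* coordinate formulas; as an identity between tensors at p holds in one      *)
(* frame iff it holds in all of them, nothing depends on the choice.          *)

Section Calculus.
Context {R : realType} {n : nat}.
Implicit Types (U V : set 'rV[R]_n) (f g : 'rV[R]_n -> R).

Definition pd (i : 'I_n) f (x : 'rV[R]_n) : R := 'D_(delta_mx 0 i) f x.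

(* U is meant to be open *)
Fixpoint Ck (k : nat) U f : Prop :=
  if k is k'.+1 then
    (forall x, U x -> differentiable f x) /\ forall i, Ck k' U (pd i f)
  else forall x, U x -> {for x, continuous f}.

Definition smooth_on U f : Prop := forall k, Ck k U f.

Lemma Ck_sub k U V f : V `<=` U -> Ck k U f -> Ck k V f.
Proof.
move=> VU; elim: k f => [|k IH] f /=; first by move=> h x /VU; exact: h.
by move=> [df pf]; split=> [x /VU|i]; [exact: df|exact: IH].
Qed.

Lemma smooth_on_sub U V f : V `<=` U -> smooth_on U f -> smooth_on V f.
Proof. by move=> VU h k; apply: Ck_sub VU _; exact: h. Qed.

Lemma CkW k U f : Ck k.+1 U f -> Ck k U f.
Proof.
elim: k f => [|k IH] f [df pf].
  by move=> x Ux; apply: differentiable_continuous; exact: df.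
by split=> // i; apply: IH; exact: pf.
Qed.

Lemma near_eq_differentiable f g x :
  (\near x, f x = g x) -> differentiable f x -> differentiable g x.
Proof.
move=> fg df; have [cdf ef] := (diff_locallyP x f).1 df.
have eg : g \o shift x = cst (g x) + 'd f x +o_ (0 : 'rV[R]_n) id.
  apply/eqaddoP => e e0; have /eqaddoP/(_ e e0) he := ef.
  have fgx : f x = g x by exact: nbhs_singleton fg.
  have fgs : \forall h \near (0 : 'rV[R]_n), f (h + x) = g (h + x).
    have sh : {for (0 : 'rV[R]_n), continuous (shift x)}.
      by apply: differentiable_continuous.
    by apply: (sh [set y | f y = g y]); rewrite /= add0r.
  apply: filterS2 he fgs => h /= he fgh.
  move: he; rewrite !fctE /= fgh fgx //.
apply/diff_locallyP; rewrite (diff_unique cdf eg); split => //.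
Qed.

Lemma Ck_ext k U f g : open U -> (forall x, U x -> f x = g x) ->
  Ck k U f -> Ck k U g.
Proof.
move=> oU; elim: k f g => [|k IH] f g fg /=.
  move=> cf x Ux; have nfg : \forall y \near x, f y = g y.
    by apply: filterS fg _; exact: open_nbhs_nbhs.
  rewrite /prop_for /continuous_at -(fg _ Ux).
  exact: cvg_trans (near_eq_cvg nfg) (cf x Ux).
move=> [df pf]; split.
  move=> x Ux; have nfg : \forall y \near x, f y = g y.
    by apply: filterS fg _; exact: open_nbhs_nbhs.
  exact: near_eq_differentiable nfg (df x Ux).
move=> i; apply: (IH (pd i f)) (pf i) => x Ux.
apply: near_eq_derive.
by apply: filterS fg _; exact: open_nbhs_nbhs.
Qed.

Lemma Ck_cst k U (a : R) : Ck k U (cst a).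
Proof.
elim: k a => [|k IH] a /=; first by move=> x _; exact: cst_continuous.
split=> [x _|i]; first exact: differentiable_cst.
suff -> : pd i (cst a) = cst 0 by exact: IH.
by apply/funext => x; rewrite /pd derive_cst.
Qed.

Lemma CkD k U f g : open U -> Ck k U f -> Ck k U g ->
  Ck k U (fun x => f x + g x).
Proof.
move=> oU; elim: k f g => [|k IH] f g /=.
  by move=> cf cg x Ux; apply: continuousD; [exact: cf|exact: cg].
move=> [df pf] [dg pg]; split=> [x Ux|i].
  by apply: differentiableD; [exact: df|exact: dg].
apply: Ck_ext (IH _ _ (pf i) (pg i)) => // x Ux.
by rewrite /pd deriveD //; apply: diff_derivable; [exact: df|exact: dg].
Qed.

Lemma CkM k U f g : open U -> Ck k U f -> Ck k U g ->
  Ck k U (fun x => f x * g x).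
Proof.
move=> oU; elim: k f g => [|k IH] f g.
  by move=> cf cg x Ux; apply: continuousM; [exact: cf|exact: cg].
move=> hf hg; have [df pf] := hf; have [dg pg] := hg; split=> [x Ux|i].
  by apply: differentiableM; [exact: df|exact: dg].
apply: Ck_ext (CkD oU (IH _ _ (CkW hf) (pg i)) (IH _ _ (CkW hg) (pf i))) => //.
move=> x Ux; rewrite /pd deriveM //; apply: diff_derivable;
  by [exact: df|exact: dg].
Qed.

Lemma smooth_onM U f g : open U -> smooth_on U f -> smooth_on U g ->
  smooth_on U (fun x => f x * g x).
Proof. by move=> oU hf hg k; apply: CkM; [exact: oU|exact: hf|exact: hg]. Qed.

Lemma smooth_on_cst U (a : R) : smooth_on U (cst a).
Proof. by move=> k; exact: Ck_cst. Qed.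

End Calculus.

Section CalculusProduct.
Context {R : realType} {n1 n2 : nat}.

Lemma derive_comp_linear (m n : nat) (L : {linear 'rV[R]_m -> 'rV[R]_n})
    (f : 'rV[R]_n -> R) (v x : 'rV[R]_m) :
  'D_v (f \o L) x = 'D_(L v) f (L x).
Proof.
rewrite /derive.
suff -> : (fun h : R => h^-1 *: (((f \o L) \o shift x) (h *: v) - (f \o L) x))
  = (fun h : R => h^-1 *: ((f \o shift (L x)) (h *: L v) - f (L x))) by [].
by apply/funext => h /=; rewrite linearP.
Qed.

Lemma pd_lsubmx (i : 'I_(n1 + n2)) (f : 'rV[R]_n1 -> R) :
  pd i (f \o lsubmx) =
  if fintype.split i is inl a then pd a f \o lsubmx else cst 0.
Proof.
apply/funext => x; rewrite /pd derive_comp_linear.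
case: split_ordP => a -> /=.
  suff -> : lsubmx (delta_mx 0 (lshift n2 a)) = delta_mx 0 a :> 'rV[R]_n1 by [].
  by apply/rowP => b; rewrite !mxE eq_lshift.
suff -> : lsubmx (delta_mx 0 (rshift n1 a)) = 0 :> 'rV[R]_n1 by exact: derive0.
by apply/rowP => b; rewrite !mxE eq_lrshift.
Qed.

Lemma pd_rsubmx (i : 'I_(n1 + n2)) (f : 'rV[R]_n2 -> R) :
  pd i (f \o rsubmx) =
  if fintype.split i is inr a then pd a f \o rsubmx else cst 0.
Proof.
apply/funext => x; rewrite /pd derive_comp_linear.
case: split_ordP => a -> /=; last first.
  suff -> : rsubmx (delta_mx 0 (rshift n1 a)) = delta_mx 0 a :> 'rV[R]_n2 by [].
  by apply/rowP => b; rewrite !mxE eq_rshift.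
suff -> : rsubmx (delta_mx 0 (lshift n2 a)) = 0 :> 'rV[R]_n2 by exact: derive0.
by apply/rowP => b; rewrite !mxE eq_rlshift.
Qed.

Lemma Ck_lsubmx k (U : set 'rV[R]_n1) (f : 'rV[R]_n1 -> R) :
  Ck k U f -> Ck k ((lsubmx : 'rV_(n1 + n2) -> _) @^-1` U) (f \o lsubmx).
Proof.
elim: k f => [|k IH] f /=.
  move=> cf x Ux; apply: continuous_comp; last exact: cf.
  exact: differentiable_continuous (differentiable_lsubmx _).
move=> [df pf]; split=> [x Ux|i].
  by apply: differentiable_comp; [exact: differentiable_lsubmx|exact: df].
rewrite pd_lsubmx; case: (fintype.split i) => a; last exact: Ck_cst.
exact: IH.
Qed.

Lemma Ck_rsubmx k (U : set 'rV[R]_n2) (f : 'rV[R]_n2 -> R) :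
  Ck k U f -> Ck k ((rsubmx : 'rV_(n1 + n2) -> _) @^-1` U) (f \o rsubmx).
Proof.
elim: k f => [|k IH] f /=.
  move=> cf x Ux; apply: continuous_comp; last exact: cf.
  exact: differentiable_continuous (differentiable_rsubmx _).
move=> [df pf]; split=> [x Ux|i].
  by apply: differentiable_comp; [exact: differentiable_rsubmx|exact: df].
rewrite pd_rsubmx; case: (fintype.split i) => a; first exact: Ck_cst.
exact: IH.
Qed.

End CalculusProduct.

(* param i is the inverse of coord i on the image coord i @` dom i; its values
   elsewhere are irrelevant *)
Record smooth_manifold (R : realType) (n : nat) := SmoothManifold {
  carrier :> topologicalType;
  carrier_hausdorff : hausdorff_space carrier;
  carrier_second_countable : @second_countable carrier;
  chart_idx : Type;
  dom : chart_idx -> set carrier;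
  coord : chart_idx -> carrier -> 'rV[R]_n;
  param : chart_idx -> 'rV[R]_n -> carrier;
  dom_open : forall i, open (dom i);
  img_open : forall i, open (coord i @` dom i);
  coordK : forall i p, dom i p -> param i (coord i p) = p;
  coord_cont : forall i p, dom i p -> {for p, continuous (coord i)};
  param_cont : forall i x, (coord i @` dom i) x ->
    {for x, continuous (param i)};
  transition_smooth : forall i j (a : 'I_n),
    smooth_on (coord i @` (dom i `&` dom j))
              (fun x => coord j (param i x) 0 a);
  chart_at : carrier -> chart_idx;
  chart_atP : forall p, dom (chart_at p) p }.

Arguments dom {R n M} i : rename.
Arguments coord {R n M} i p : rename.
Arguments param {R n M} i x : rename.
Arguments chart_at {R n M} p : rename.

Section Manifold.
Context {R : realType} {n : nat} (M : smooth_manifold R n).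

Definition img (i : chart_idx M) : set 'rV[R]_n := coord i @` dom i.

Definition smooth_fun (f : M -> R) : Prop :=
  forall i, smooth_on (img i) (f \o param i).

Record pos_smooth_fun := PosSmoothFun {
  psf :> M -> R;
  psf_gt0 : forall p, 0 < psf p;
  psf_smooth : smooth_fun psf }.

(* Row a holds the components of the a-th coordinate vector of chart i in the
   frame of chart j *)
Definition transition_jacobian (i j : chart_idx M) (x : 'rV[R]_n) : 'M[R]_n :=
  \matrix_(a, b) pd a (fun y => coord j (param i y) 0 b) x.

(* gcomp i x a b is the component g_ab of the metric in chart i, as a function of
   the coordinate x *)
Record riemannian_metric := RiemannianMetric {
  gcomp :> chart_idx M -> 'rV[R]_n -> 'M[R]_n;
  gcomp_smooth : forall i a b, smooth_on (img i) (fun x => gcomp i x a b);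
  gcomp_sym : forall i x, img i x -> (gcomp i x)^T = gcomp i x;
  gcomp_pos : forall i x (u : 'rV[R]_n), img i x -> u != 0 ->
    0 < (u *m gcomp i x *m u^T) 0 0;
  gcomp_compat : forall i j x, (coord i @` (dom i `&` dom j)) x ->
    gcomp i x = transition_jacobian i j x *m gcomp j (coord j (param i x))
                *m (transition_jacobian i j x)^T }.

End Manifold.

Arguments img {R n M} i.
Arguments carrier_hausdorff {R n} M : rename.
Arguments carrier_second_countable {R n} M : rename.

Section ProductManifold.
Context {R : realType} {n1 n2 : nat}.
Variables (M1 : smooth_manifold R n1) (M2 : smooth_manifold R n2).

Let T := (M1 * M2)%type.
Let I := (chart_idx M1 * chart_idx M2)%type.

Definition prod_dom (i : I) : set T := dom i.1 `*` dom i.2.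
Definition prod_coord (i : I) (p : T) : 'rV[R]_(n1 + n2) :=
  row_mx (coord i.1 p.1) (coord i.2 p.2).
Definition prod_param (i : I) (x : 'rV[R]_(n1 + n2)) : T :=
  (param i.1 (lsubmx x), param i.2 (rsubmx x)).
Definition prod_chart_at (p : T) : I := (chart_at p.1, chart_at p.2).

Lemma prod_img (A1 : set M1) (A2 : set M2) (i : I) :
  prod_coord i @` (A1 `*` A2) =
  (lsubmx @^-1` (coord i.1 @` A1)) `&` (rsubmx @^-1` (coord i.2 @` A2)).
Proof.
apply/seteqP; split=> [_ [[p1 p2] [/= h1 h2] <-]|x [[p1 h1 e1] [p2 h2 e2]]].
  by split; rewrite /prod_coord /= ?row_mxKl ?row_mxKr; [exists p1|exists p2].
by exists (p1, p2) => //; rewrite /prod_coord /= e1 e2 hsubmxK.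
Qed.

Lemma prod_domI i j : prod_dom i `&` prod_dom j =
  (dom i.1 `&` dom j.1) `*` (dom i.2 `&` dom j.2).
Proof. by apply/seteqP; split=> [p [[? ?] [? ?]]|p [[? ?] [? ?]]]. Qed.

Lemma setX_open (A1 : set M1) (A2 : set M2) :
  open A1 -> open A2 -> open (A1 `*` A2 : set T).
Proof.
rewrite !openE => o1 o2 [p1 p2] [/= /o1 h1 /o2 h2].
by exists (A1, A2).
Qed.

Lemma prod_hausdorff : hausdorff_space T.
Proof.
move: (carrier_hausdorff M1) (carrier_hausdorff M2).
move=> h1 h2 [p1 p2] [q1 q2] cl; congr pair.
  apply: h1 => A B pA qB.
  have [] := cl (A `*` setT) (B `*` setT).
  - by exists (A, setT) => //; split=> //; exact: filterT.
  - by exists (B, setT) => //; split=> //; exact: filterT.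
  by move=> [a b] [[Aa _] [Ba _]]; exists a.
apply: h2 => A B pA qB.
have [] := cl (setT `*` A) (setT `*` B).
- by exists (setT, A) => //; split=> //; exact: filterT.
- by exists (setT, B) => //; split=> //; exact: filterT.
by move=> [a b] [[_ Ab] [_ Bb]]; exists b.
Qed.

Lemma prod_second_countable : @second_countable T.
Proof.
have [B1 cB1 [oB1 bB1]] := carrier_second_countable M1.
have [B2 cB2 [oB2 bB2]] := carrier_second_countable M2.
exists ((fun AB : set M1 * set M2 => AB.1 `*` AB.2) @` (B1 `*` B2)).
  apply: (sub_countable (card_image_le _ _)); exact: countableX.
split=> [_ [[A B] [/= hA hB] <-]|[p1 p2] A /= [[U V] [/= hU hV] UVA]].
  by apply: setX_open; [exact: oB1|exact: oB2].
have [U' [B1U' U'p] U'U] := bB1 p1 _ hU.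
have [V' [B2V' V'p] V'V] := bB2 p2 _ hV.
exists (U' `*` V').
  by split => //; exists (U', V').
by move=> [a b] [/= /U'U ? /V'V ?]; exact: UVA.
Qed.

Lemma prod_dom_open i : open (prod_dom i).
Proof. by apply: setX_open; exact: dom_open. Qed.

Lemma prod_img_open i : open (prod_coord i @` prod_dom i).
Proof.
rewrite prod_img; apply: openI; apply: open_comp; try exact: img_open.
- by move=> x _; apply: differentiable_continuous; exact: differentiable_lsubmx.
- by move=> x _; apply: differentiable_continuous; exact: differentiable_rsubmx.
Qed.

Lemma prod_coordK i p : prod_dom i p -> prod_param i (prod_coord i p) = p.
Proof.
by case: p => p1 p2 [/= h1 h2]; rewrite /prod_param row_mxKl row_mxKr !coordK.
Qed.

Lemma continuous_rV (X : topologicalType) (m : nat) (f : X -> 'rV[R]_m) (p : X) :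
  (forall a, {for p, continuous (fun q => f q 0 a)}) -> {for p, continuous f}.
Proof.
move=> cf A [P nP PA].
have : \forall q \near p, forall a : 'I_m, P 0 a (f q 0 a).
  by apply: filter_forall => a; apply: cf; exact: nP.
apply: filterS => q Pq; apply: PA => i a; rewrite ord1; exact: Pq.
Qed.

Lemma prod_coord_cont i p : prod_dom i p -> {for p, continuous (prod_coord i)}.
Proof.
case: p => p1 p2 [/= h1 h2]; apply: continuous_rV => a.
rewrite /prod_coord; case: (split_ordP a) => b ->.
  have -> : (fun q : T => row_mx (coord i.1 q.1) (coord i.2 q.2) 0 (lshift n2 b))
      = (fun x : 'rV[R]_n1 => x 0 b) \o (coord i.1 \o fst).
    by apply/funext => q /=; rewrite row_mxEl.
  apply: continuous_comp; last exact: coord_continuous.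
  apply: continuous_comp; first exact: cvg_fst.
  exact: coord_cont.
have -> : (fun q : T => row_mx (coord i.1 q.1) (coord i.2 q.2) 0 (rshift n1 b))
    = (fun x : 'rV[R]_n2 => x 0 b) \o (coord i.2 \o snd).
  by apply/funext => q /=; rewrite row_mxEr.
apply: continuous_comp; last exact: coord_continuous.
apply: continuous_comp; first exact: cvg_snd.
exact: coord_cont.
Qed.

Lemma prod_param_cont i x : (prod_coord i @` prod_dom i) x ->
  {for x, continuous (prod_param i)}.
Proof.
rewrite prod_img => -[/= h1 h2].
have c1 : {for x, continuous (param i.1 \o @lsubmx R 1 n1 n2)}.
  apply: continuous_comp; last exact: param_cont.
  by apply: differentiable_continuous; exact: differentiable_lsubmx.
have c2 : {for x, continuous (param i.2 \o @rsubmx R 1 n1 n2)}.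
  apply: continuous_comp; last exact: param_cont.
  by apply: differentiable_continuous; exact: differentiable_rsubmx.
exact: cvg_pair c1 c2.
Qed.

Lemma prod_transition_lshift i j (a : 'I_n1) :
  (fun x => prod_coord j (prod_param i x) 0 (lshift n2 a)) =
  (fun y => coord j.1 (param i.1 y) 0 a) \o lsubmx.
Proof. by apply/funext => x /=; rewrite /prod_coord row_mxEl. Qed.

Lemma prod_transition_rshift i j (a : 'I_n2) :
  (fun x => prod_coord j (prod_param i x) 0 (rshift n1 a)) =
  (fun y => coord j.2 (param i.2 y) 0 a) \o rsubmx.
Proof. by apply/funext => x /=; rewrite /prod_coord row_mxEr. Qed.

Lemma prod_transition_smooth i j (a : 'I_(n1 + n2)) :
  smooth_on (prod_coord i @` (prod_dom i `&` prod_dom j))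
            (fun x => prod_coord j (prod_param i x) 0 a).
Proof.
rewrite prod_domI prod_img => k; case: (split_ordP a) => b ->.
  rewrite prod_transition_lshift; apply: Ck_sub (@subIsetl _ _ _) _.
  exact: Ck_lsubmx (transition_smooth _ _ _ _).
rewrite prod_transition_rshift; apply: Ck_sub (@subIsetr _ _ _) _.
exact: Ck_rsubmx (transition_smooth _ _ _ _).
Qed.

Lemma prod_chart_atP p : prod_dom (prod_chart_at p) p.
Proof. by split; exact: chart_atP. Qed.

Definition prod_manifold : smooth_manifold R (n1 + n2) :=
  SmoothManifold prod_hausdorff prod_second_countable prod_dom_open
    prod_img_open prod_coordK prod_coord_cont prod_param_cont
    prod_transition_smooth prod_chart_atP.

End ProductManifold.

Section DoublyWarpedProduct.
Context {R : realType} {n1 n2 : nat}.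
Context {M1 : smooth_manifold R n1} {M2 : smooth_manifold R n2}.
Variables (g1 : riemannian_metric M1) (g2 : riemannian_metric M2).
Variables (f1 : pos_smooth_fun M1) (f2 : pos_smooth_fun M2).

Let M := prod_manifold M1 M2.

(* (f2 o pi2)^2 pi1^*(g1) + (f1 o pi1)^2 pi2^*(g2) in product charts, where the
   differentials of pi1 and pi2 are lsubmx and rsubmx (see dwp_innerE) *)
Definition dwp_comp (i : chart_idx M) (x : 'rV[R]_(n1 + n2)) : 'M[R]_(n1 + n2) :=
  block_mx (f2 (param i.2 (rsubmx x)) ^+ 2 *: g1 i.1 (lsubmx x)) 0
           0 (f1 (param i.1 (lsubmx x)) ^+ 2 *: g2 i.2 (rsubmx x)).

Lemma dwp_smooth i a b : smooth_on (img i) (fun x => dwp_comp i x a b).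
Proof.
have imgE : img i = (lsubmx @^-1` img i.1) `&` (rsubmx @^-1` img i.2).
  exact: prod_img.
have oU : open (img i) by exact: img_open.
have sl (f : 'rV[R]_n1 -> R) : smooth_on (img i.1) f ->
    smooth_on (img i) (f \o lsubmx).
  by move=> sf; rewrite imgE => k; apply: Ck_sub (Ck_lsubmx (sf k)) => x [].
have sr (f : 'rV[R]_n2 -> R) : smooth_on (img i.2) f ->
    smooth_on (img i) (f \o rsubmx).
  by move=> sf; rewrite imgE => k; apply: Ck_sub (Ck_rsubmx (sf k)) => x [].
rewrite /dwp_comp.
case: (split_ordP a) => a' ->; case: (split_ordP b) => b' ->.
- have -> : (fun x => block_mx (f2 (param i.2 (rsubmx x)) ^+ 2 *: g1 i.1 (lsubmx x))
      0 0 (f1 (param i.1 (lsubmx x)) ^+ 2 *: g2 i.2 (rsubmx x))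
      (lshift n2 a') (lshift n2 b')) =
    (fun x => ((f2 \o param i.2) \o rsubmx) x * ((f2 \o param i.2) \o rsubmx) x
              * ((fun y => g1 i.1 y a' b') \o lsubmx) x).
    by apply/funext => x; rewrite block_mxEul mxE.
  have s2 := sr _ (psf_smooth f2 i.2).
  by apply: smooth_onM => //; [exact: smooth_onM|exact: sl (gcomp_smooth _ _ _ _)].
- have -> : (fun x => block_mx (f2 (param i.2 (rsubmx x)) ^+ 2 *: g1 i.1 (lsubmx x))
      0 0 (f1 (param i.1 (lsubmx x)) ^+ 2 *: g2 i.2 (rsubmx x))
      (lshift n2 a') (rshift n1 b')) = cst 0.
    by apply/funext => x; rewrite block_mxEur mxE.
  exact: smooth_on_cst.
- have -> : (fun x => block_mx (f2 (param i.2 (rsubmx x)) ^+ 2 *: g1 i.1 (lsubmx x))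
      0 0 (f1 (param i.1 (lsubmx x)) ^+ 2 *: g2 i.2 (rsubmx x))
      (rshift n1 a') (lshift n2 b')) = cst 0.
    by apply/funext => x; rewrite block_mxEdl mxE.
  exact: smooth_on_cst.
- have -> : (fun x => block_mx (f2 (param i.2 (rsubmx x)) ^+ 2 *: g1 i.1 (lsubmx x))
      0 0 (f1 (param i.1 (lsubmx x)) ^+ 2 *: g2 i.2 (rsubmx x))
      (rshift n1 a') (rshift n1 b')) =
    (fun x => ((f1 \o param i.1) \o lsubmx) x * ((f1 \o param i.1) \o lsubmx) x
              * ((fun y => g2 i.2 y a' b') \o rsubmx) x).
    by apply/funext => x; rewrite block_mxEdr mxE.
  have s1 := sl _ (psf_smooth f1 i.1).
  by apply: smooth_onM => //; [exact: smooth_onM|exact: sr (gcomp_smooth _ _ _ _)].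
Qed.

Lemma dwp_sym i x : img i x -> (dwp_comp i x)^T = dwp_comp i x.
Proof.
rewrite [img i]prod_img => -[h1 h2]; rewrite /dwp_comp tr_block_mx !trmx0.
by rewrite !linearZ /= !gcomp_sym.
Qed.

Lemma dwp_compE i x (u v : 'rV[R]_(n1 + n2)) :
  (u *m dwp_comp i x *m v^T) 0 0 =
  f2 (param i.2 (rsubmx x)) ^+ 2 *
    (lsubmx u *m g1 i.1 (lsubmx x) *m (lsubmx v)^T) 0 0 +
  f1 (param i.1 (lsubmx x)) ^+ 2 *
    (rsubmx u *m g2 i.2 (rsubmx x) *m (rsubmx v)^T) 0 0.
Proof.
rewrite /dwp_comp -{1}(hsubmxK u) -{1}(hsubmxK v) mul_row_block !mulmx0 addr0 add0r.
by rewrite tr_row_mx mul_row_col -!scalemxAr -!scalemxAl !mxE.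
Qed.

Lemma dwp_pos i x (u : 'rV[R]_(n1 + n2)) : img i x -> u != 0 ->
  0 < (u *m dwp_comp i x *m u^T) 0 0.
Proof.
rewrite [img i]prod_img => -[/= h1 h2] u0; rewrite dwp_compE.
have ge1 (v : 'rV_n1) : 0 <= (v *m g1 i.1 (lsubmx x) *m v^T) 0 0.
  have [->|v0] := eqVneq v 0; first by rewrite !mul0mx mxE.
  by apply: ltW; exact: gcomp_pos.
have ge2 (v : 'rV_n2) : 0 <= (v *m g2 i.2 (rsubmx x) *m v^T) 0 0.
  have [->|v0] := eqVneq v 0; first by rewrite !mul0mx mxE.
  by apply: ltW; exact: gcomp_pos.
have F1 p : 0 < f1 p ^+ 2 by rewrite exprn_gt0 ?psf_gt0.
have F2 p : 0 < f2 p ^+ 2 by rewrite exprn_gt0 ?psf_gt0.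
have [ul0|ul0] := eqVneq (lsubmx u) 0.
  apply: ltr_wpDl; first by apply: mulr_ge0 => //; exact: ltW.
  apply: mulr_gt0 => //; apply: gcomp_pos => //.
  by apply: contra_neq u0 => ur0; rewrite -(hsubmxK u) ul0 ur0 row_mx0.
apply: ltr_wpDr; first by apply: mulr_ge0 => //; exact: ltW.
by apply: mulr_gt0 => //; exact: gcomp_pos.
Qed.

Lemma dwp_jacobian (i j : chart_idx M) x :
  transition_jacobian i j x =
  block_mx (transition_jacobian i.1 j.1 (lsubmx x)) 0
           0 (transition_jacobian i.2 j.2 (rsubmx x)).
Proof.
have El (a : 'I_(n1 + n2)) (b : 'I_n1) :
    transition_jacobian i j x a (lshift n2 b) =
    pd a ((fun y => coord j.1 (param i.1 y) 0 b) \o lsubmx) x.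
  by rewrite mxE -prod_transition_lshift.
have Er (a : 'I_(n1 + n2)) (b : 'I_n2) :
    transition_jacobian i j x a (rshift n1 b) =
    pd a ((fun y => coord j.2 (param i.2 y) 0 b) \o rsubmx) x.
  by rewrite mxE -prod_transition_rshift.
apply/matrixP => a b.
case: (split_ordP b) => b' ->; [rewrite El pd_lsubmx|rewrite Er pd_rsubmx];
case: (split_ordP a) => a' -> /=.
- by rewrite block_mxEul mxE.
- by rewrite block_mxEdl mxE.
- by rewrite block_mxEur mxE.
- by rewrite block_mxEdr mxE.
Qed.

Lemma dwp_compat (i j : chart_idx M) x : (coord i @` (dom i `&` dom j)) x ->
  dwp_comp i x = transition_jacobian i j x *m dwp_comp j (coord j (param i x))
                 *m (transition_jacobian i j x)^T.
Proof.
have -> : coord i @` (dom i `&` dom j) = prod_coord i @` (prod_dom i `&` prod_dom j).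
  by [].
rewrite prod_domI prod_img => -[/= h1 h2].
rewrite dwp_jacobian /dwp_comp tr_block_mx !trmx0 !mulmx_block.
rewrite !(mulmx0, mul0mx, addr0, add0r).
have e1 : param j.1 (coord j.1 (param i.1 (lsubmx x))) = param i.1 (lsubmx x).
  by apply: coordK; case: h1 => p [pi pj] <-; rewrite coordK.
have e2 : param j.2 (coord j.2 (param i.2 (rsubmx x))) = param i.2 (rsubmx x).
  by apply: coordK; case: h2 => p [pi pj] <-; rewrite coordK.
rewrite /= /prod_coord /= row_mxKl row_mxKr e1 e2.
by rewrite -!scalemxAr -!scalemxAl -(gcomp_compat g1 h1) -(gcomp_compat g2 h2).
Qed.

Definition dwp_metric : riemannian_metric M :=
  RiemannianMetric dwp_smooth dwp_sym dwp_pos dwp_compat.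

End DoublyWarpedProduct.

Section LocalGeometry.
Context {R : realType} {n : nat} (G : 'rV[R]_n -> 'M[R]_n).
Implicit Types (x : 'rV[R]_n) (i j k l : 'I_n).

(* Gamma^k_ij of the Levi-Civita connection: nabla_(d_i) d_j = Gamma^k_ij d_k *)
Definition christoffel x i j k : R :=
  2^-1 * \sum_l invmx (G x) k l *
    (pd i (fun y => G y j l) x + pd j (fun y => G y i l) x
     - pd l (fun y => G y i j) x).

(* d_i (d_j f) - (nabla_(d_i) d_j) f *)
Definition local_hess (f : 'rV[R]_n -> R) x i j : R :=
  pd i (pd j f) x - \sum_k christoffel x i j k * pd k f x.

(* The d_l-component of R(d_i, d_j) d_k, where
   R(X, Y) Z = nabla_X nabla_Y Z - nabla_Y nabla_X Z - nabla_[X, Y] Z *)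
Definition local_curv x i j k l : R :=
  pd i (fun y => christoffel y j k l) x - pd j (fun y => christoffel y i k l) x
  + \sum_s (christoffel x j k s * christoffel x i s l
            - christoffel x i k s * christoffel x j s l).

(* R(d_i, d_j, d_k, d_l) = g(R(d_i, d_j) d_k, d_l) *)
Definition local_riem x i j k l : R := \sum_s local_curv x i j k s * G x s l.

(* Ric(d_j, d_k), the contraction over the first and last arguments *)
Definition local_ric x j k : R :=
  \sum_i \sum_l invmx (G x) i l * local_riem x i j k l.

End LocalGeometry.

Section Geometry.
Context {R : realType} {n : nat} {M : smooth_manifold R n}.

Definition local_rep (f : M -> R) (p : M) : 'rV[R]_n -> R :=
  f \o param (chart_at p).

Definition at_chart (p : M) : 'rV[R]_n := coord (chart_at p) p.

Definition differential (f : M -> R) (p : M) (u : 'rV[R]_n) : R :=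
  \sum_i u 0 i * pd i (local_rep f p) (at_chart p).

Variable g : riemannian_metric M.

Definition metric_mx (p : M) : 'M[R]_n := g (chart_at p) (at_chart p).

Definition inner (p : M) (u v : 'rV[R]_n) : R := (u *m metric_mx p *m v^T) 0 0.

(* The vector dual to the differential of f for the metric *)
Definition grad (f : M -> R) (p : M) : 'rV[R]_n :=
  \row_j \sum_i pd i (local_rep f p) (at_chart p) * invmx (metric_mx p) i j.

Definition hess (f : M -> R) (p : M) (u v : 'rV[R]_n) : R :=
  \sum_i \sum_j u 0 i * v 0 j *
    local_hess (g (chart_at p)) (local_rep f p) (at_chart p) i j.

(* The metric trace of hess *)
Definition laplacian (f : M -> R) (p : M) : R :=
  \sum_i \sum_j invmx (metric_mx p) i j *
    local_hess (g (chart_at p)) (local_rep f p) (at_chart p) i j.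

Definition riem (p : M) (u v w z : 'rV[R]_n) : R :=
  \sum_i \sum_j \sum_k \sum_l u 0 i * v 0 j * w 0 k * z 0 l *
    local_riem (g (chart_at p)) (at_chart p) i j k l.

Definition ric (p : M) (u v : 'rV[R]_n) : R :=
  \sum_i \sum_j u 0 i * v 0 j * local_ric (g (chart_at p)) (at_chart p) i j.

(* Both sides of the soliton equations are tensorial, so vector fields are
   replaced by their values, tangent vectors at p *)
Definition gradient_riemann_soliton (psi : M -> R) (lambda : R) : Prop :=
  smooth_fun psi /\
  forall p (X Y Z W : 'rV[R]_n),
    riem p X Y Z W
    + inner p X W * hess psi p Y Z + inner p Y Z * hess psi p X W
    - inner p X Z * hess psi p Y W - inner p Y W * hess psi p X Z
    = lambda * (inner p X W * inner p Y Z - inner p X Z * inner p Y W).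

(* lambda and mu are functions; eta is a 1-form *)
Definition gradient_almost_eta_ricci_soliton
    (phi lambda mu : M -> R) (eta : M -> 'rV[R]_n -> R) : Prop :=
  smooth_fun phi /\
  forall p (X Y : 'rV[R]_n),
    ric p X Y + hess phi p X Y
    = lambda p * inner p X Y + mu p * (eta p X * eta p Y).

End Geometry.

Lemma dwp_innerE (R : realType) (n1 n2 : nat)
    (M1 : smooth_manifold R n1) (M2 : smooth_manifold R n2)
    (g1 : riemannian_metric M1) (g2 : riemannian_metric M2)
    (f1 : pos_smooth_fun M1) (f2 : pos_smooth_fun M2)
    (p1 : M1) (p2 : M2) (u v : 'rV[R]_(n1 + n2)) :
  inner (dwp_metric g1 g2 f1 f2) (p1, p2) u v =
  f2 p2 ^+ 2 * inner g1 p1 (lsubmx u) (lsubmx v) +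
  f1 p1 ^+ 2 * inner g2 p2 (rsubmx u) (rsubmx v).
Proof.
rewrite /inner /metric_mx /= dwp_compE /at_chart /= /prod_coord /=.
by rewrite row_mxKl row_mxKr !coordK //; exact: chart_atP.
Qed.

(* Main.v *)
Require Import Defs.
From mathcomp Require Import all_boot all_order all_algebra.
From mathcomp Require Import all_classical all_reals all_analysis.
From mathcomp Require Import ring.

Set Implicit Arguments.
Unset Strict Implicit.
Unset Printing Implicit Defensive.

Import Order.TTheory GRing.Theory Num.Theory.
Import numFieldNormedType.Exports.

Local Open Scope classical_set_scope.
Local Open Scope ring_scope.

(** Contracting the Riemann soliton equation over its first and last arguments
    gives [Ric + (m - 2) Hess psi + (laplacian psi) g = (m - 1) lambda g] on the
    product ([soliton_trace]). It remains to read this equation on two vectors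
    tangent to the first factor.

    In a product chart with coordinates [(y, z)] the metric is
    [F2(z)^2 g1(y) + F1(y)^2 g2(z)]. Write [k = ln F1], [l = ln F2] and [X] for
    the [g2]-gradient of [l]. For indices [a, b, c] on the left and [u, v] on the
    right, the Christoffel symbols are those of the factors, together with
    [Gamma_au^c = delta_ac d_u l], [Gamma_au^v = delta_uv d_a k] and
    [Gamma_ab^u = - (F2^2 / F1^2) g1_ab X^u], up to the exchange of the factors.
    Consequently, on left directions,
    - [Hess psi = Hess1 (psi restricted to the slice) + g <grad l, grad psi>]
      ([local_hess_left], [inner_log_warp]);
    - [Ric = Ric1 - m2 (Hess1 k + dk dk) - (laplacian l) g]
      ([local_ric_left], [laplacian_log_warp]).
    In the second formula the derivatives [d_u Gamma_ab^u] and the products of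
    Christoffel symbols assemble into a divergence, which is a Laplacian because
    the trace of a Hessian is the divergence of the gradient
    ([laplacian_divergence]).

    Both corrections proportional to [g] go to the right-hand side of the traced
    equation, where [g = f2^2 g1]; what is left is the eta-Ricci soliton equation
    of the slice ([slice_soliton_equation]). The splitting of the coordinates is
    handled abstractly and symmetrically, so the statement on the second factor
    is the one on the first after exchanging the roles of the two groups of
    coordinates. *)

(** * Calculus of smooth functions on coordinate domains *)

Section SmoothFunctions.
Context {R : realType} {n : nat}.
Implicit Types (U : set 'rV[R]_n) (f g : 'rV[R]_n -> R) (x : 'rV[R]_n).

Lemma eq_smooth_on U f g : open U -> (forall x, U x -> f x = g x) ->
  smooth_on U f -> smooth_on U g.
Proof. by move=> oU fg sf k; apply: (Ck_ext oU fg). Qed.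

Lemma smooth_onD U f g : open U -> smooth_on U f -> smooth_on U g ->
  smooth_on U (fun x => f x + g x).
Proof. by move=> oU sf sg k; apply: CkD. Qed.

Lemma smooth_on_sum U (I : Type) (r : seq I) (P : pred I) (F : I -> 'rV[R]_n -> R) :
  open U -> (forall i, smooth_on U (F i)) ->
  smooth_on U (fun x => \sum_(i <- r | P i) F i x).
Proof.
move=> oU sF; elim: r => [|i r IH].
  rewrite (_ : (fun x => _) = cst 0); first exact: smooth_on_cst.
  by apply/funext => x; rewrite big_nil.
case Pi: (P i).
  rewrite (_ : (fun x => _) = (fun x => F i x + \sum_(j <- r | P j) F j x)).
    exact: smooth_onD.
  by apply/funext => x; rewrite big_cons Pi.
rewrite (_ : (fun x => _) = (fun x => \sum_(j <- r | P j) F j x)) //.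
by apply/funext => x; rewrite big_cons Pi.
Qed.

Lemma smooth_on_prod U (I : Type) (r : seq I) (P : pred I) (F : I -> 'rV[R]_n -> R) :
  open U -> (forall i, smooth_on U (F i)) ->
  smooth_on U (fun x => \prod_(i <- r | P i) F i x).
Proof.
move=> oU sF; elim: r => [|i r IH].
  rewrite (_ : (fun x => _) = cst 1); first exact: smooth_on_cst.
  by apply/funext => x; rewrite big_nil.
case Pi: (P i).
  rewrite (_ : (fun x => _) = (fun x => F i x * \prod_(j <- r | P j) F j x)).
    exact: smooth_onM.
  by apply/funext => x; rewrite big_cons Pi.
rewrite (_ : (fun x => _) = (fun x => \prod_(j <- r | P j) F j x)) //.
by apply/funext => x; rewrite big_cons Pi.
Qed.

Lemma smooth_on_pd U f i : smooth_on U f -> smooth_on U (pd i f).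
Proof. by move=> sf k; have [_] := sf k.+1; apply. Qed.

Lemma smooth_on_differentiable U f x : smooth_on U f -> U x -> differentiable f x.
Proof. by move=> sf; have [+ _] := sf 1; apply. Qed.

Lemma smooth_on_derivable U f x v : smooth_on U f -> U x -> derivable f x v.
Proof. by move=> sf Ux; apply: diff_derivable; apply: smooth_on_differentiable Ux. Qed.

Lemma eq_on_pd U f g i x : open U -> (forall y, U y -> f y = g y) -> U x ->
  pd i f x = pd i g x.
Proof.
move=> oU fg Ux; apply: near_eq_derive; apply: filterS fg _.
exact: open_nbhs_nbhs.
Qed.

Lemma pdM U f g i x : smooth_on U f -> smooth_on U g -> U x ->
  pd i (fun y => f y * g y) x = f x * pd i g x + g x * pd i f x.
Proof.
move=> sf sg Ux.
by rewrite /pd (@deriveM _ _ f g) //; apply: (smooth_on_derivable (U := U)).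
Qed.

Lemma pdD U f g i x : smooth_on U f -> smooth_on U g -> U x ->
  pd i (fun y => f y + g y) x = pd i f x + pd i g x.
Proof.
move=> sf sg Ux.
by rewrite /pd (@deriveD _ _ _ f g) //; apply: (smooth_on_derivable (U := U)).
Qed.

Lemma pd_cst (c : R) i x : pd i (fun=> c) x = 0.
Proof. exact: derive_cst. Qed.

Lemma pdZ U f c i x : smooth_on U f -> U x ->
  pd i (fun y => c * f y) x = c * pd i f x.
Proof.
by move=> sf Ux; rewrite (pdM i (smooth_on_cst U c) sf Ux) pd_cst mulr0 addr0.
Qed.

Lemma pd_sum U m (F : 'I_m -> 'rV[R]_n -> R) i x :
  (forall j, smooth_on U (F j)) -> U x ->
  pd i (fun y => \sum_(j < m) F j y) x = \sum_(j < m) pd i (F j) x.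
Proof.
move=> sF Ux; rewrite /pd -derive_sum; last first.
  by move=> j; apply: smooth_on_derivable (sF j) Ux.
by congr ('D_ _ _ _); apply/funext => y; rewrite fct_sumE.
Qed.

Lemma smooth_onV U f : open U -> (forall x, U x -> f x != 0) -> smooth_on U f ->
  smooth_on U (fun x => (f x)^-1).
Proof.
move=> oU f0 sf k; elim: k => [|k IH].
  move=> x Ux; apply: continuousV; first exact: f0.
  exact: differentiable_continuous (smooth_on_differentiable sf Ux).
split=> [x Ux|i].
  by apply: differentiableV; [exact: smooth_on_differentiable sf Ux|exact: f0].
have Cpd : Ck k U (pd i f) by exact: smooth_on_pd.
apply: Ck_ext (CkM oU (Ck_cst k U (-1)) (CkM oU (CkM oU IH IH) Cpd)) => // x Ux.
rewrite /pd deriveV ?f0 //; last exact: smooth_on_derivable sf Ux.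
by rewrite -[RHS]/(_ * _) expr2 invfM mulN1r mulNr.
Qed.

Lemma derive_ln_comp f x v : 0 < f x -> differentiable f x ->
  differentiable (@ln R \o f) x /\ 'D_v (@ln R \o f) x = (f x)^-1 * 'D_v f x.
Proof.
move=> f0 df; have dl := is_derive1_ln f0.
have [dl1 El] := dl.
have dln : differentiable (@ln R) (f x) by apply/derivable1_diffP.
have dlf : differentiable (@ln R \o f) x by exact: differentiable_comp.
split=> //; rewrite deriveE // diff_comp //= deriveE // deriv1E //.
by rewrite derive1E El [RHS]mulrC.
Qed.

Lemma pd_ln U f i x : (forall y, 0 < f y) -> smooth_on U f -> U x ->
  pd i (@ln R \o f) x = (f x)^-1 * pd i f x.
Proof.
move=> f0 sf Ux; rewrite /pd.
by have [] := derive_ln_comp (delta_mx 0 i) (f0 x) (smooth_on_differentiable sf Ux).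
Qed.

Lemma smooth_on_ln U f : open U -> (forall x, 0 < f x) -> smooth_on U f ->
  smooth_on U (@ln R \o f).
Proof.
move=> oU f0 sf; case=> [|k].
  move=> x Ux; apply: differentiable_continuous.
  by have [] := derive_ln_comp 0 (f0 x) (smooth_on_differentiable sf Ux).
split=> [x Ux|i].
  by have [] := derive_ln_comp 0 (f0 x) (smooth_on_differentiable sf Ux).
have sV : smooth_on U (fun x => (f x)^-1).
  by apply: smooth_onV => // x _; rewrite gt_eqF.
apply: Ck_ext (CkM oU (sV k) (smooth_on_pd i sf k)) => // x Ux.
by rewrite (pd_ln i f0 sf Ux).
Qed.

Lemma smooth_on_det U p (A : 'rV[R]_n -> 'M[R]_p) : open U ->
  (forall i j, smooth_on U (fun x => A x i j)) -> smooth_on U (fun x => \det (A x)).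
Proof.
move=> oU sA; apply: smooth_on_sum => // s; apply: smooth_onM => //.
  exact: smooth_on_cst.
by apply: smooth_on_prod.
Qed.

(** Cramer's rule writes the entries of the inverse as quotients of
    polynomials in the entries of [A]. *)
Lemma smooth_on_invmx U p (A : 'rV[R]_n -> 'M[R]_p) i j : open U ->
  (forall x, U x -> A x \in unitmx) ->
  (forall i j, smooth_on U (fun x => A x i j)) ->
  smooth_on U (fun x => invmx (A x) i j).
Proof.
move=> oU uA sA.
have sV : smooth_on U (fun x => (\det (A x))^-1).
  apply: smooth_onV => //; last exact: smooth_on_det.
  by move=> x /uA; rewrite unitmxE unitfE.
have sadj : smooth_on U (fun x => (\adj (A x)) i j).
  rewrite (_ : (fun x => _) =
    (fun x => (-1) ^+ (j + i) * \det (row' j (col' i (A x))))).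
    apply: smooth_onM => //; first exact: smooth_on_cst.
    apply: smooth_on_det => // a b.
    rewrite (_ : (fun x => _) = (fun x => A x (lift j a) (lift i b))) //.
    by apply/funext => x; rewrite !mxE.
  by apply/funext => x; rewrite mxE.
apply: (eq_smooth_on oU _ (smooth_onM oU sV sadj)) => x Ux.
by rewrite /invmx uA // [RHS]mxE.
Qed.

End SmoothFunctions.

Section Slices.
Context {R : realType} {a n : nat}.
Variables (J : 'I_a -> 'I_n) (S : 'rV[R]_a -> 'rV[R]_n).
Hypothesis S_translate : forall i (h : R) y,
  S (h *: delta_mx 0 i + y) = h *: delta_mx 0 (J i) + S y.

Lemma derive_slice (f : 'rV[R]_n -> R) i y :
  'D_(delta_mx 0 i) (f \o S) y = 'D_(delta_mx 0 (J i)) f (S y).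
Proof.
rewrite /derive.
suff -> : (fun h : R => h^-1 *:
      (((f \o S) \o shift y) (h *: delta_mx 0 i) - (f \o S) y)) =
    (fun h : R => h^-1 *:
      ((f \o shift (S y)) (h *: delta_mx 0 (J i)) - f (S y))) by [].
by apply/funext => h /=; rewrite S_translate.
Qed.

(** The difference quotients along the slice and in the ambient space coincide,
    so that the equality can be iterated to derivatives of every order. *)
Lemma pd_slice (f : 'rV[R]_n -> R) i : pd i (f \o S) = pd (J i) f \o S.
Proof. by apply/funext => y; exact: derive_slice. Qed.

Lemma smooth_on_slice (U : set 'rV[R]_n) f : (forall y, differentiable S y) ->
  smooth_on U f -> smooth_on (S @^-1` U) (f \o S).
Proof.
move=> dS sf k; elim: k f sf => [|k IH] f sf /=.
  move=> y Uy; apply: continuous_comp.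
    exact: differentiable_continuous (dS y).
  exact: differentiable_continuous (smooth_on_differentiable sf Uy).
split=> [y Uy|i].
  by apply: differentiable_comp; [exact: dS|exact: smooth_on_differentiable sf Uy].
by rewrite pd_slice; apply: IH; exact: smooth_on_pd.
Qed.

End Slices.

(** * Metrics in a single chart *)

Section KroneckerSums.
Context {R : realType} {n : nat}.
Implicit Types F : 'I_n -> R.

Lemma sum_deltal F k : \sum_i (i == k)%:R * F i = F k.
Proof.
rewrite (bigD1 k) //= eqxx mul1r big1 ?addr0 // => i /negPf ->.
by rewrite mul0r.
Qed.

Lemma sum_deltar F k : \sum_i (k == i)%:R * F i = F k.
Proof. by rewrite -[RHS](sum_deltal F k); apply: eq_bigr => i _; rewrite eq_sym. Qed.

Lemma mulVmx_entry (A : 'M[R]_n) i k : A \in unitmx ->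
  \sum_j invmx A i j * A j k = (i == k)%:R.
Proof. by move=> uA; move: (congr1 (fun B : 'M[R]_n => B i k) (mulVmx uA)); rewrite !mxE. Qed.

Lemma mulVmx_diag (A : 'M[R]_n) i : A \in unitmx -> \sum_j invmx A i j * A j i = 1.
Proof. by move=> uA; rewrite mulVmx_entry // eqxx. Qed.

Lemma mulmxV_entry (A : 'M[R]_n) i k : A \in unitmx ->
  \sum_j A i j * invmx A j k = (i == k)%:R.
Proof. by move=> uA; move: (congr1 (fun B : 'M[R]_n => B i k) (mulmxV uA)); rewrite !mxE. Qed.

Lemma invmx_sym (A : 'M[R]_n) i j : A^T = A -> invmx A i j = invmx A j i.
Proof. by move=> sA; rewrite -{1}sA -trmx_inv mxE. Qed.

End KroneckerSums.

Section ChartMetric.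
Context {R : realType} {n : nat}.

Record chart_metric (U : set 'rV[R]_n) (G : 'rV[R]_n -> 'M[R]_n) := ChartMetric {
  cm_open : open U;
  cm_smooth : forall i j, smooth_on U (fun x => G x i j);
  cm_sym : forall x, U x -> (G x)^T = G x;
  cm_unit : forall x, U x -> G x \in unitmx }.

Variables (U : set 'rV[R]_n) (G : 'rV[R]_n -> 'M[R]_n).
Hypothesis gG : chart_metric U G.
Implicit Types (x : 'rV[R]_n) (i j k l s : 'I_n).

Let Ginv x : 'M[R]_n := invmx (G x).
Let Gamma := christoffel G.

Lemma metric_entry_sym x i j : U x -> G x i j = G x j i.
Proof. by move=> Ux; rewrite -{1}(cm_sym gG Ux) mxE. Qed.

Lemma pd_metric_sym x k i j : U x ->
  pd k (fun y => G y i j) x = pd k (fun y => G y j i) x.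
Proof.
by apply: eq_on_pd (cm_open gG) _ => y; exact: metric_entry_sym.
Qed.

Lemma inverse_metric_smooth i j : smooth_on U (fun x => Ginv x i j).
Proof.
apply: smooth_on_invmx; [exact: cm_open gG|exact: cm_unit gG|exact: cm_smooth gG].
Qed.

Lemma inverse_metric_sym x i j : U x -> Ginv x i j = Ginv x j i.
Proof. by move=> Ux; apply: invmx_sym; exact: cm_sym gG _ Ux. Qed.

Lemma christoffel_sym x i j k : U x -> Gamma x i j k = Gamma x j i k.
Proof.
move=> Ux; congr (_ * _); apply: eq_bigr => l _; congr (_ * _).
by rewrite (pd_metric_sym l i j Ux); ring.
Qed.

(** Lowering the upper index undoes the inverse metric in the Christoffel
    symbols and leaves the Koszul formula. *)
Lemma christoffel_lower x i j l : U x ->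
  \sum_k Gamma x i j k * G x k l =
  2^-1 * (pd i (fun y => G y j l) x + pd j (fun y => G y i l) x
          - pd l (fun y => G y i j) x).
Proof.
move=> Ux; pose D s := pd i (fun y => G y j s) x + pd j (fun y => G y i s) x
  - pd s (fun y => G y i j) x.
transitivity (2^-1 * \sum_k \sum_s Ginv x k s * D s * G x k l).
  rewrite mulr_sumr; apply: eq_bigr => k _.
  by rewrite /Gamma /christoffel -mulrA mulr_suml.
congr (_ * _); rewrite exchange_big /= -[RHS](sum_deltal D l).
apply: eq_bigr => s _; rewrite -(mulVmx_entry s l (cm_unit gG Ux)) mulr_suml.
by apply: eq_bigr => k _; rewrite inverse_metric_sym // -mulrA [D s * _]mulrC mulrA.
Qed.

Lemma metric_compatibility x k i j : U x ->
  pd k (fun y => G y i j) x =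
  \sum_s (Gamma x k i s * G x s j + Gamma x k j s * G x s i).
Proof.
move=> Ux; rewrite big_split /= !christoffel_lower //.
by rewrite (pd_metric_sym k j i Ux) (pd_metric_sym i k j Ux) (pd_metric_sym j k i Ux);
  field.
Qed.

(** Differentiating [Ginv G = 1] gives [d Ginv = - Ginv (d G) Ginv]; substituting
    [d_k G = C G + (C G)^T], which is metric compatibility with [C] the matrix of
    Christoffel symbols in direction [k], the factors [G] and [Ginv] cancel. *)
Lemma pd_inverse_metric x k i j : U x ->
  pd k (fun y => Ginv y i j) x =
  - \sum_s (Gamma x k s i * Ginv x s j + Gamma x k s j * Ginv x s i).
Proof.
move=> Ux; have uG := cm_unit gG Ux.
pose D := \matrix_(a, b) pd k (fun y => G y a b) x.
pose D' := \matrix_(a, b) pd k (fun y => Ginv y a b) x.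
pose C := \matrix_(a, b) Gamma x k a b.
have ED : D = C *m G x + (C *m G x)^T.
  apply/matrixP => a b; rewrite !mxE metric_compatibility // big_split /=.
  by congr (_ + _); apply: eq_bigr => s _; rewrite !mxE.
have E0 : D' *m G x + Ginv x *m D = 0.
  apply/matrixP => a b; rewrite !mxE -big_split /=.
  have : pd k (fun y => \sum_s Ginv y a s * G y s b) x = 0.
    rewrite -[RHS](pd_cst (a == b)%:R k x); apply: (eq_on_pd (U := U)) => //.
      exact: cm_open gG.
    by move=> y Uy; rewrite mulVmx_entry ?(cm_unit gG).
  rewrite (pd_sum (U := U)) //; last first.
    move=> s; apply: smooth_onM; [exact: cm_open gG|exact: inverse_metric_smooth|].
    exact: cm_smooth gG _ _.
  move=> E; rewrite -[RHS]E; apply: eq_bigr => s _; rewrite !mxE.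
  rewrite (pdM _ (inverse_metric_smooth a s) (cm_smooth gG s b) Ux).
  by ring.
have ED' : D' = - (Ginv x *m C + (Ginv x *m C)^T).
  apply: (can_inj (mulmxK uG)); rewrite -[LHS](addrK (Ginv x *m D)) E0 sub0r.
  rewrite ED mulNmx; congr (- _); rewrite mulmxDr mulmxDl mulmxA; congr (_ + _).
  rewrite !trmx_mul (cm_sym gG Ux) mulmxA mulVmx // mul1mx.
  by rewrite trmx_inv (cm_sym gG Ux) -mulmxA mulVmx // mulmx1.
have := congr1 (fun A : 'M[R]_n => A i j) ED'; rewrite !mxE => ->.
rewrite big_split /= addrC; congr (- (_ + _)); apply: eq_bigr => s _;
  by rewrite !mxE inverse_metric_sym // mulrC.
Qed.

(** Lowering the last index of the curvature and contracting it with the inverse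
    metric is the trace of the curvature with its last index up. *)
Lemma local_ricE x j k : U x ->
  local_ric G x j k = \sum_i local_curv G x i j k i.
Proof.
move=> Ux; apply: eq_bigr => i _.
rewrite -(sum_deltal (local_curv G x i j k) i).
under eq_bigr => l _ do rewrite mulr_sumr.
rewrite exchange_big /=; apply: eq_bigr => s _.
rewrite -(mulmxV_entry s i (cm_unit gG Ux)) mulr_suml; apply: eq_bigr => l _.
by rewrite -/(Ginv x) (inverse_metric_sym i l Ux); ring.
Qed.

(** The trace of the Hessian is the divergence of the gradient, the latter
    written with the contracted Christoffel symbols. Of the two terms of
    [pd_inverse_metric], one cancels these symbols and the other is the
    first-order term of the Hessian. *)
Lemma laplacian_divergence (f : 'rV[R]_n -> R) x : smooth_on U f -> U x ->
  \sum_i \sum_j Ginv x i j * local_hess G f x i j =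
  \sum_i (pd i (fun y => \sum_j Ginv y i j * pd j f y) x
          + \sum_j (\sum_k Ginv x j k * pd k f x) * Gamma x i j i).
Proof.
move=> sf Ux.
have spd j : smooth_on U (pd j f) by exact: smooth_on_pd.
pose X j := \sum_k Ginv x j k * pd k f x.
have divE i : pd i (fun y => \sum_j Ginv y i j * pd j f y) x =
    \sum_j Ginv x i j * pd i (pd j f) x
    - \sum_s Gamma x i s i * X s - \sum_j \sum_s Gamma x i s j * Ginv x s i * pd j f x.
  rewrite (pd_sum (U := U)) //; last first.
    by move=> j; apply: smooth_onM (inverse_metric_smooth i j) (spd j); exact: cm_open gG.
  under eq_bigr => j _ do rewrite (pdM _ (inverse_metric_smooth i j) (spd j) Ux).
  rewrite big_split /= -addrA; congr (_ + _).
  rewrite -opprD /X; under [in RHS]eq_bigr => s _ do rewrite mulr_sumr.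
  rewrite [in RHS]exchange_big -big_split -sumrN /=; apply: eq_bigr => j _.
  rewrite pd_inverse_metric // -big_split mulrN; congr (- _).
  by rewrite mulr_sumr; apply: eq_bigr => s _ /=; ring.
under [RHS]eq_bigr => i _ do rewrite divE.
rewrite !big_split /= !sumrN.
have -> : \sum_i \sum_j X j * Gamma x i j i = \sum_i \sum_s Gamma x i s i * X s.
  by apply: eq_bigr => i _; apply: eq_bigr => s _; rewrite mulrC.
rewrite [X in _ = X](_ : _ = \sum_i \sum_j Ginv x i j * pd i (pd j f) x
  - \sum_i \sum_j \sum_s Gamma x i s j * Ginv x s i * pd j f x); last by ring.
rewrite -sumrB.
transitivity (\sum_i \sum_j Ginv x i j * pd i (pd j f) x
  - \sum_i \sum_j Ginv x i j * \sum_k Gamma x i j k * pd k f x).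
  rewrite -sumrB; apply: eq_bigr => i _; rewrite -sumrB; apply: eq_bigr => j _.
  by rewrite mulrBr.
rewrite -sumrB; apply: eq_bigr => i _; congr (_ - _).
rewrite exchange_big /=; apply: eq_bigr => j _.
rewrite mulr_sumr; apply: eq_bigr => k _.
by rewrite (inverse_metric_sym j i Ux); ring.
Qed.

Lemma local_hessB (f h : 'rV[R]_n -> R) (c d : R) x i j :
  smooth_on U f -> smooth_on U h -> U x ->
  local_hess G (fun y => c * f y - d * h y) x i j =
  c * local_hess G f x i j - d * local_hess G h x i j.
Proof.
move=> sf sh Ux; have oU := cm_open gG.
have pdlin (u v : 'rV[R]_n -> R) k y : smooth_on U u -> smooth_on U v -> U y ->
    pd k (fun y => c * u y - d * v y) y = c * pd k u y - d * pd k v y.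
  move=> su sv Uy.
  have -> : (fun y => c * u y - d * v y) = (fun y => c * u y + (- d) * v y).
    by apply/funext => z; rewrite mulNr.
  rewrite (pdD (U := U)) //; do ?[by apply: smooth_onM => //; exact: smooth_on_cst].
  by rewrite !(pdZ (U := U)) // mulNr.
rewrite /local_hess.
rewrite (eq_on_pd (g := fun y => c * pd j f y - d * pd j h y) i oU _ Ux); last first.
  by move=> y Uy; exact: pdlin.
rewrite pdlin //; do ?exact: smooth_on_pd.
have -> : \sum_k christoffel G x i j k * pd k (fun y => c * f y - d * h y) x =
    c * \sum_k christoffel G x i j k * pd k f x
    - d * \sum_k christoffel G x i j k * pd k h x.
  rewrite !mulr_sumr -sumrB; apply: eq_bigr => k _; rewrite pdlin //.
  by ring.
have E (p q s t : R) : c * p - d * q - (c * s - d * t) = c * (p - s) - d * (q - t).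
  by ring.
exact: E.
Qed.

End ChartMetric.

(** * Warped metrics in split coordinates *)

Section CoordinateSplitting.
Context {R : realType}.

(** Left and right enter symmetrically and only through index maps and
    projections. The two factors of a product can thus be exchanged without
    casting along [n1 + n2 = n2 + n1], and every statement on the left factor
    yields its counterpart on the right. *)
Record coord_splitting (n n1 n2 : nat) := CoordSplitting {
  left_idx : 'I_n1 -> 'I_n;
  right_idx : 'I_n2 -> 'I_n;
  left_proj : {linear 'rV[R]_n -> 'rV[R]_n1};
  right_proj : {linear 'rV[R]_n -> 'rV[R]_n2};
  sum_split : forall F : 'I_n -> R,
    \sum_i F i = \sum_i F (left_idx i) + \sum_j F (right_idx j);
  left_proj_left : forall i, left_proj (delta_mx 0 (left_idx i)) = delta_mx 0 i;
  left_proj_right : forall j, left_proj (delta_mx 0 (right_idx j)) = 0;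
  right_proj_left : forall i, right_proj (delta_mx 0 (left_idx i)) = 0;
  right_proj_right : forall j, right_proj (delta_mx 0 (right_idx j)) = delta_mx 0 j }.

Definition swap_splitting n n1 n2 (s : coord_splitting n n1 n2) :
    coord_splitting n n2 n1.
Proof.
apply: (@CoordSplitting n n2 n1 (right_idx s) (left_idx s) (right_proj s) (left_proj s)).
- by move=> F; rewrite addrC; exact: sum_split.
- exact: right_proj_right.
- exact: right_proj_left.
- exact: left_proj_right.
- exact: left_proj_left.
Defined.

Variables (n n1 n2 : nat) (s : coord_splitting n n1 n2).

Lemma pd_left_pullback (f : 'rV[R]_n1 -> R) i x :
  pd (left_idx s i) (f \o left_proj s) x = pd i f (left_proj s x).
Proof. by rewrite /pd derive_comp_linear left_proj_left. Qed.

Lemma pd_right_pullback (f : 'rV[R]_n1 -> R) j x :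
  pd (right_idx s j) (f \o left_proj s) x = 0.
Proof. by rewrite /pd derive_comp_linear left_proj_right derive0. Qed.

Lemma pd_left_separable U (u : 'rV[R]_n1 -> R) (v : 'rV[R]_n2 -> R) i x :
  smooth_on U u -> U (left_proj s x) ->
  pd (left_idx s i) (fun y => u (left_proj s y) * v (right_proj s y)) x =
  pd i u (left_proj s x) * v (right_proj s x).
Proof.
move=> su Ux; rewrite mulrC -(pdZ _ _ su Ux) /pd /derive.
set F := (fun h : R => _); set F' := (fun h : R => _).
suff -> : F = F' by [].
apply/funext => h; rewrite /F /F' /= !(linearP (left_proj s)).
rewrite !(linearP (right_proj s)) left_proj_left right_proj_left.
by rewrite scaler0 add0r ![v _ * _]mulrC.
Qed.

End CoordinateSplitting.

Section WarpedChart.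
Context {R : realType}.

(** [G] is the metric [F2 ^ 2 g1 + F1 ^ 2 g2] read in a product chart. *)
Record warped_chart (n n1 n2 : nat) (s : @coord_splitting R n n1 n2)
    (U : set 'rV[R]_n) (G : 'rV[R]_n -> 'M[R]_n)
    (U1 : set 'rV[R]_n1) (g1 : 'rV[R]_n1 -> 'M[R]_n1) (F1 : 'rV[R]_n1 -> R)
    (U2 : set 'rV[R]_n2) (g2 : 'rV[R]_n2 -> 'M[R]_n2) (F2 : 'rV[R]_n2 -> R) :=
  WarpedChart {
  wc_metric : chart_metric U G;
  wc_left_metric : chart_metric U1 g1;
  wc_right_metric : chart_metric U2 g2;
  wc_left_dom : forall x, U x -> U1 (left_proj s x);
  wc_right_dom : forall x, U x -> U2 (right_proj s x);
  wc_left_gt0 : forall y, 0 < F1 y;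
  wc_right_gt0 : forall z, 0 < F2 z;
  wc_left_smooth : smooth_on U1 F1;
  wc_right_smooth : smooth_on U2 F2;
  wc_ll : forall x i j, G x (left_idx s i) (left_idx s j) =
    g1 (left_proj s x) i j * F2 (right_proj s x) ^+ 2;
  wc_rr : forall x i j, G x (right_idx s i) (right_idx s j) =
    g2 (right_proj s x) i j * F1 (left_proj s x) ^+ 2;
  wc_lr : forall x i j, G x (left_idx s i) (right_idx s j) = 0;
  wc_rl : forall x i j, G x (right_idx s i) (left_idx s j) = 0;
  wc_inv_ll : forall x i j, U x -> invmx (G x) (left_idx s i) (left_idx s j) =
    (F2 (right_proj s x) ^+ 2)^-1 * invmx (g1 (left_proj s x)) i j;
  wc_inv_rr : forall x i j, U x -> invmx (G x) (right_idx s i) (right_idx s j) =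
    (F1 (left_proj s x) ^+ 2)^-1 * invmx (g2 (right_proj s x)) i j;
  wc_inv_lr : forall x i j, U x ->
    invmx (G x) (left_idx s i) (right_idx s j) = 0;
  wc_inv_rl : forall x i j, U x ->
    invmx (G x) (right_idx s i) (left_idx s j) = 0 }.

Lemma swap_warped_chart n n1 n2 (s : @coord_splitting R n n1 n2) U G U1 g1 F1 U2 g2 F2 :
  warped_chart s U G U1 g1 F1 U2 g2 F2 ->
  warped_chart (swap_splitting s) U G U2 g2 F2 U1 g1 F1.
Proof. by case=> *; split. Qed.

(** Logarithmic derivatives make all Christoffel symbols of the warped metric
    free of derivatives of [F1] and [F2] themselves. *)
Lemma pd_sqr n (U : set 'rV[R]_n) (F : 'rV[R]_n -> R) i x :
  (forall y, 0 < F y) -> smooth_on U F -> U x ->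
  pd i (fun y => F y ^+ 2) x = 2 * F x ^+ 2 * pd i (@ln R \o F) x.
Proof.
move=> F0 sF Ux; rewrite (pd_ln i F0 sF Ux).
rewrite -[LHS]/(pd i (fun y => F y * F y) x) (pdM i sF sF Ux).
by have := F0 x => /gt_eqF/negbT ?; field.
Qed.

Lemma smooth_on_sqr n (U : set 'rV[R]_n) (F : 'rV[R]_n -> R) :
  open U -> smooth_on U F -> smooth_on U (fun y => F y ^+ 2).
Proof. by move=> oU sF; exact: smooth_onM. Qed.

Section Christoffel.
Variables (n n1 n2 : nat) (s : @coord_splitting R n n1 n2).
Variables (U : set 'rV[R]_n) (G : 'rV[R]_n -> 'M[R]_n).
Variables (U1 : set 'rV[R]_n1) (g1 : 'rV[R]_n1 -> 'M[R]_n1) (F1 : 'rV[R]_n1 -> R).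
Variables (U2 : set 'rV[R]_n2) (g2 : 'rV[R]_n2 -> 'M[R]_n2) (F2 : 'rV[R]_n2 -> R).
Hypothesis W : warped_chart s U G U1 g1 F1 U2 g2 F2.

Let L := left_idx s.
Let D := right_idx s.
Let lp := left_proj s.
Let rp := right_proj s.

Lemma pd_left_ll x i j k : U x ->
  pd (L i) (fun y => G y (L j) (L k)) x =
  pd i (fun y => g1 y j k) (lp x) * F2 (rp x) ^+ 2.
Proof.
move=> Ux; under eq_fun => y do rewrite (wc_ll W).
apply: (pd_left_separable (s := s) (u := fun y => g1 y j k) (fun z => F2 z ^+ 2)).
  exact: cm_smooth (wc_left_metric W) j k.
exact: wc_left_dom W _ Ux.
Qed.

Lemma pd_right_ll x j k c : U x ->
  pd (D c) (fun y => G y (L j) (L k)) x =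
  2 * F2 (rp x) ^+ 2 * pd c (@ln R \o F2) (rp x) * g1 (lp x) j k.
Proof.
move=> Ux; have Uz := wc_right_dom W Ux.
rewrite -(pd_sqr _ (wc_right_gt0 W) (wc_right_smooth W) Uz).
under eq_fun => y do rewrite (wc_ll W) mulrC.
apply: (pd_left_separable (s := swap_splitting s)
  (u := fun z => F2 z ^+ 2) (fun y => g1 y j k)) Uz.
by apply: smooth_on_sqr (wc_right_smooth W); exact: cm_open (wc_right_metric W).
Qed.

Lemma pd_lr x e i j : pd e (fun y => G y (L i) (D j)) x = 0.
Proof. by under eq_fun => y do rewrite (wc_lr W); exact: pd_cst. Qed.

Lemma pd_rl x e i j : pd e (fun y => G y (D i) (L j)) x = 0.
Proof. by under eq_fun => y do rewrite (wc_rl W); exact: pd_cst. Qed.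

Let F2n0 z : F2 z ^+ 2 != 0.
Proof. by rewrite expf_neq0 // gt_eqF // (wc_right_gt0 W). Qed.

Lemma christoffel_lll x i j k : U x ->
  christoffel G x (L i) (L j) (L k) = christoffel g1 (lp x) i j k.
Proof.
move=> Ux; rewrite /christoffel (sum_split s); congr (_ * _).
rewrite [X in _ + X]big1 ?addr0; last by move=> c _; rewrite (wc_inv_lr W) // mul0r.
apply: eq_bigr => l _; rewrite (wc_inv_ll W) // !pd_left_ll //.
by have := F2n0 (rp x); rewrite -/(lp x) -/(rp x); move: (F2 _ ^+ 2) => r r0; field.
Qed.

Definition log_grad (z : 'rV[R]_n2) c : R :=
  \sum_d invmx (g2 z) c d * pd d (@ln R \o F2) z.

Lemma christoffel_llr x i j c : U x ->
  christoffel G x (L i) (L j) (D c) =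
  - (g1 (lp x) i j * (F1 (lp x) ^+ 2)^-1) * (F2 (rp x) ^+ 2 * log_grad (rp x) c).
Proof.
move=> Ux; rewrite /christoffel (sum_split s).
rewrite big1 ?add0r; last by move=> k _; rewrite (wc_inv_rl W) // mul0r.
rewrite /log_grad !mulr_sumr; apply: eq_bigr => d _.
rewrite (wc_inv_rr W) // !pd_lr pd_right_ll //.
by rewrite -/(lp x) -/(rp x); field; rewrite gt_eqF // (wc_left_gt0 W).
Qed.

Lemma christoffel_lrl x i c k : U x ->
  christoffel G x (L i) (D c) (L k) = (i == k)%:R * pd c (@ln R \o F2) (rp x).
Proof.
move=> Ux; rewrite /christoffel (sum_split s).
rewrite [X in _ + X]big1 ?addr0; last by move=> d _; rewrite (wc_inv_lr W) // mul0r.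
rewrite eq_sym -(mulVmx_entry k i (cm_unit (wc_left_metric W) (wc_left_dom W Ux))).
rewrite mulr_sumr mulr_suml; apply: eq_bigr => l _.
rewrite (wc_inv_ll W) // pd_rl pd_lr pd_right_ll //.
rewrite (metric_entry_sym (wc_left_metric W) i l (wc_left_dom W Ux)).
by have := F2n0 (rp x); rewrite -/(lp x) -/(rp x); move: (F2 _ ^+ 2) => r r0; field.
Qed.

Lemma christoffel_rll x i c k : U x ->
  christoffel G x (D c) (L i) (L k) = (i == k)%:R * pd c (@ln R \o F2) (rp x).
Proof. by move=> Ux; rewrite (christoffel_sym (wc_metric W)) // christoffel_lrl. Qed.

End Christoffel.
End WarpedChart.

(** * Hessian, Laplacian and Ricci tensor of a warped metric *)

Section RicciWarped.
Context {R : realType}.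
Variables (n n1 n2 : nat) (s : @coord_splitting R n n1 n2).
Variables (U : set 'rV[R]_n) (G : 'rV[R]_n -> 'M[R]_n).
Variables (U1 : set 'rV[R]_n1) (g1 : 'rV[R]_n1 -> 'M[R]_n1) (F1 : 'rV[R]_n1 -> R).
Variables (U2 : set 'rV[R]_n2) (g2 : 'rV[R]_n2 -> 'M[R]_n2) (F2 : 'rV[R]_n2 -> R).
Hypothesis W : warped_chart s U G U1 g1 F1 U2 g2 F2.

Let L := left_idx s.
Let D := right_idx s.
Let lp := left_proj s.
Let rp := right_proj s.
Let W' := swap_warped_chart W.
Let k := @ln R \o F1.
Let l := @ln R \o F2.
Let X := log_grad g2 F2.
(* The factor depending on the left coordinates in the symbol Gamma_ab^c with
   [a, b] on the left and [c] on the right; it is constant when differentiating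
   in the right directions. *)
Let coupling a b y : R := g1 y a b * (F1 y ^+ 2)^-1.

Let christoffel_rlr x c i e : U x ->
  christoffel G x (D c) (L i) (D e) = (c == e)%:R * pd i k (lp x).
Proof. exact: christoffel_lrl W' x c i e. Qed.

Let christoffel_lrr x i c e : U x ->
  christoffel G x (L i) (D c) (D e) = (c == e)%:R * pd i k (lp x).
Proof. exact: christoffel_rll W' x c i e. Qed.

Let christoffel_rrr x c d e : U x ->
  christoffel G x (D c) (D d) (D e) = christoffel g2 (rp x) c d e.
Proof. exact: christoffel_lll W' x c d e. Qed.

Lemma log_smooth : smooth_on U2 l.
Proof.
apply: smooth_on_ln; first exact: cm_open (wc_right_metric W).
  exact: wc_right_gt0 W.
exact: wc_right_smooth W.
Qed.

Lemma log_grad_smooth c : smooth_on U2 (X ^~ c).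
Proof.
have oU := cm_open (wc_right_metric W); apply: smooth_on_sum => // d.
apply: smooth_onM => //; last exact: smooth_on_pd log_smooth.
exact: inverse_metric_smooth (wc_right_metric W) _ _.
Qed.

Lemma pd_christoffel_lll x e i j h : U x ->
  pd (L e) (fun y => christoffel G y (L i) (L j) (L h)) x =
  pd e (fun y => christoffel g1 y i j h) (lp x).
Proof.
move=> Ux; rewrite -(pd_left_pullback s (fun y => christoffel g1 y i j h)).
apply: eq_on_pd (cm_open (wc_metric W)) _ Ux => y Uy.
exact: christoffel_lll W _ _ _ _ Uy.
Qed.

Lemma pd_christoffel_rlr x e c j : U x ->
  pd (L e) (fun y => christoffel G y (D c) (L j) (D c)) x = pd e (pd j k) (lp x).
Proof.
move=> Ux; rewrite -(pd_left_pullback s (pd j k)).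
apply: eq_on_pd (cm_open (wc_metric W)) _ Ux => y Uy.
by rewrite christoffel_rlr // eqxx mul1r.
Qed.

Lemma pd_christoffel_llr x c i j : U x ->
  pd (D c) (fun y => christoffel G y (L i) (L j) (D c)) x =
  - coupling i j (lp x) * (F2 (rp x) ^+ 2 *
    (2 * pd c l (rp x) * X (rp x) c + pd c (X ^~ c) (rp x))).
Proof.
move=> Ux; have Uz := wc_right_dom W Ux.
have oU := cm_open (wc_right_metric W).
have sF := smooth_on_sqr oU (wc_right_smooth W).
have sX := log_grad_smooth c.
have -> : pd (D c) (fun y => christoffel G y (L i) (L j) (D c)) x =
    pd (D c) (fun y => F2 (rp y) ^+ 2 * X (rp y) c * - coupling i j (lp y)) x.
  apply: eq_on_pd (cm_open (wc_metric W)) _ Ux => y Uy.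
  by rewrite (christoffel_llr W) // mulrC.
have sFX : smooth_on U2 (fun z => F2 z ^+ 2 * X z c) by exact: smooth_onM.
rewrite (pd_left_separable (s := swap_splitting s) (fun y => - coupling i j y) c sFX) //.
rewrite (pdM c sF sX Uz) (pd_sqr c (wc_right_gt0 W) (wc_right_smooth W) Uz).
by rewrite -/(rp x) -/l [LHS]mulrC; congr (_ * _); rewrite /=; ring.
Qed.

(** [F1 ^ 2] times the Laplacian of [l] for the warped metric, see
    [laplacian_log_warp]. *)
Definition warp_laplacian (z : 'rV[R]_n2) : R :=
  \sum_i \sum_j invmx (g2 z) i j * local_hess g2 l z i j
  + n1%:R * \sum_c X z c * pd c l z.

(** The trace over left indices gives the Ricci tensor of the left factor and
    [n1 - 1] copies of [Gamma_ab^d d_d l]. The trace over right indices gives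
    [- (Hess k + dk dk)] once per right index, minus one more copy of
    [Gamma_ab^d d_d l], and the divergence on the right factor of the field
    [Gamma_ab^c]. Since this field is [F2 ^ 2 X] up to a factor constant in the
    right coordinates, its divergence contributes the Laplacian of [l] on the
    right factor and two copies of [<X, dl>], hence [n1] copies in total. *)
Lemma local_ric_left x a b : U x ->
  local_ric G x (L a) (L b) =
  local_ric g1 (lp x) a b
  - n2%:R * (local_hess g1 k (lp x) a b + pd a k (lp x) * pd b k (lp x))
  - coupling a b (lp x) * F2 (rp x) ^+ 2 * warp_laplacian (rp x).
Proof.
move=> Ux; have Uy := wc_left_dom W Ux; have Uz := wc_right_dom W Ux.
rewrite (local_ricE (wc_metric W)) // (sum_split s) -/L -/D.
pose N c := christoffel G x (L a) (L b) (D c).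
have ll c : local_curv G x (L c) (L a) (L b) (L c) =
    local_curv g1 (lp x) c a b c
    + \sum_d (N d * pd d l (rp x) - (c == a)%:R * (N d * pd d l (rp x))).
  rewrite /local_curv (sum_split s) -/L -/D !pd_christoffel_lll // addrA.
  congr (_ + _ + _).
    by apply: eq_bigr => d _; rewrite !(christoffel_lll W).
  apply: eq_bigr => d _; rewrite !(christoffel_lrl W) // eqxx mul1r -/(N d).
  have [->|ca] := eqVneq c a; first by rewrite !mul1r.
  by rewrite !mul0r mulr0.
have rr c : local_curv G x (D c) (L a) (L b) (D c) =
    - (local_hess g1 k (lp x) a b + pd a k (lp x) * pd b k (lp x))
    + (pd (D c) (fun y => christoffel G y (L a) (L b) (D c)) x
       - N c * pd c l (rp x)
       + \sum_d N d * christoffel g2 (rp x) c d c).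
  rewrite /local_curv (sum_split s) -/L -/D pd_christoffel_rlr //.
  have -> : \sum_i (christoffel G x (L a) (L b) (L i) * christoffel G x (D c) (L i) (D c)
       - christoffel G x (D c) (L b) (L i) * christoffel G x (L a) (L i) (D c)) =
      \sum_i christoffel g1 (lp x) a b i * pd i k (lp x) - N c * pd c l (rp x).
    rewrite sumrB; congr (_ - _).
      by apply: eq_bigr => i _; rewrite (christoffel_lll W) // christoffel_rlr // eqxx mul1r.
    rewrite -[RHS](sum_deltar (fun i => christoffel G x (L a) (L i) (D c) * pd c l (rp x)) b).
    by apply: eq_bigr => i _; rewrite (christoffel_rll W) //; rewrite -/(rp x) -/l /=; ring.
  have -> : \sum_j (christoffel G x (L a) (L b) (D j) * christoffel G x (D c) (D j) (D c)
       - christoffel G x (D c) (L b) (D j) * christoffel G x (L a) (D j) (D c)) =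
      \sum_d N d * christoffel g2 (rp x) c d c - pd a k (lp x) * pd b k (lp x).
    rewrite sumrB; congr (_ - _).
      by apply: eq_bigr => d _; rewrite christoffel_rrr.
    rewrite -[RHS](sum_deltar (fun=> pd a k (lp x) * pd b k (lp x)) c).
    apply: eq_bigr => d _; rewrite (christoffel_rlr c b d Ux) (christoffel_lrr a d c Ux).
    move: (pd a k (lp x)) (pd b k (lp x)) => ka kb.
    by have [_|_] := eqVneq c d; rewrite ?mul0r // !mul1r mulrC.
  (* Stated over scalars, so that the tensors are matched without unfolding. *)
  have E (p q u v w t : R) :
    p - q + (u - v + (w - t)) = - (q - u + t) + (p - v + w) by ring.
  exact: E.
under eq_bigr => c _ do rewrite ll.
under [X in _ + X]eq_bigr => c _ do rewrite rr.
rewrite big_split /= -/(local_ric _ _ _ _) -(local_ricE (wc_left_metric W)) //.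
rewrite -[RHS]addrA -[LHS]addrA; congr (_ + _).
have -> : \sum_c \sum_d (N d * pd d l (rp x) - (c == a)%:R * (N d * pd d l (rp x))) =
   (n1%:R - 1) * \sum_d N d * pd d l (rp x).
  under eq_bigr => c _ do rewrite sumrB -mulr_sumr.
  rewrite sumrB sum_deltal sumr_const card_ord -mulr_natl; ring.
rewrite big_split /= sumr_const card_ord -[X in _ + (X + _)]mulr_natl.
rewrite big_split /= sumrB.
have EN c : N c = - coupling a b (lp x) * (F2 (rp x) ^+ 2 * X (rp x) c).
  exact: christoffel_llr W _ _ _ _ Ux.
rewrite [X in _ + (_ + X)](_ : _ = - coupling a b (lp x) * F2 (rp x) ^+ 2 *
   (\sum_c (pd c (X ^~ c) (rp x) + \sum_d X (rp x) d * christoffel g2 (rp x) c d c)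
    + \sum_c X (rp x) c * pd c l (rp x))); last first.
  rewrite -big_split /= -sumrB -big_split mulr_sumr; apply: eq_bigr => c _.
  rewrite pd_christoffel_llr // EN.
  have -> : \sum_d N d * christoffel g2 (rp x) c d c = - coupling a b (lp x) *
      F2 (rp x) ^+ 2 * \sum_d X (rp x) d * christoffel g2 (rp x) c d c.
    by rewrite mulr_sumr; apply: eq_bigr => d _; rewrite EN; ring.
  by rewrite /=; ring.
have -> : \sum_d N d * pd d l (rp x) = - coupling a b (lp x) * F2 (rp x) ^+ 2 *
    \sum_c X (rp x) c * pd c l (rp x).
  by rewrite mulr_sumr; apply: eq_bigr => d _; rewrite EN; ring.
rewrite -(laplacian_divergence (wc_right_metric W) log_smooth Uz) /warp_laplacian.
have E (d1 d2 p c f q r : R) :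
    (d1 - 1) * (- c * f * r) + (d2 * - p + - c * f * (q + r)) =
    - (d2 * p) - c * f * (q + d1 * r) by ring.
exact: E.
Qed.

Lemma local_hess_left (f : 'rV[R]_n -> R) x i j : U x ->
  local_hess G f x (L i) (L j) =
  pd (L i) (pd (L j) f) x
  - \sum_e christoffel g1 (lp x) i j e * pd (L e) f x
  + coupling i j (lp x) * F2 (rp x) ^+ 2 * \sum_c X (rp x) c * pd (D c) f x.
Proof.
move=> Ux; rewrite /local_hess (sum_split s) -/L -/D opprD addrA; congr (_ - _ + _).
  by apply: eq_bigr => e _; rewrite (christoffel_lll W).
rewrite mulr_sumr -sumrN; apply: eq_bigr => c _; rewrite (christoffel_llr W) //.
by rewrite -/(lp x) -/(rp x) -/(coupling i j (lp x)) -/(X (rp x) c); ring.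
Qed.

Let pd_left_l i : pd (L i) (l \o rp) = cst 0.
Proof. by apply/funext => y; exact: pd_right_pullback (swap_splitting s) _ _ _. Qed.

Let pd_right_l c : pd (D c) (l \o rp) = pd c l \o rp.
Proof. by apply/funext => y; exact: pd_left_pullback (swap_splitting s) _ _ _. Qed.

(** Along left directions the Hessian of [l] is [<grad l, grad l> g], and the
    trace of [g] there is [n1]: this is the second term of [warp_laplacian]. *)
Lemma laplacian_log_warp x : U x ->
  \sum_i \sum_j invmx (G x) i j * local_hess G (l \o rp) x i j =
  (F1 (lp x) ^+ 2)^-1 * warp_laplacian (rp x).
Proof.
move=> Ux; have Uy := wc_left_dom W Ux.
have F2n0 : F2 (rp x) ^+ 2 != 0 by rewrite expf_neq0 // gt_eqF // (wc_right_gt0 W).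
have hl i j : local_hess G (l \o rp) x (L i) (L j) =
    coupling i j (lp x) * F2 (rp x) ^+ 2 * \sum_c X (rp x) c * pd c l (rp x).
  rewrite local_hess_left // pd_left_l pd_cst sub0r big1; last first.
    by move=> e _; rewrite pd_left_l mulr0.
  by rewrite oppr0 add0r; congr (_ * _); apply: eq_bigr => c _; rewrite pd_right_l.
have hr i j : local_hess G (l \o rp) x (D i) (D j) = local_hess g2 l (rp x) i j.
  rewrite /local_hess (sum_split s) -/L -/D pd_right_l.
  rewrite [pd (D i) _ x](pd_left_pullback (swap_splitting s)); congr (_ - _).
  rewrite big1 ?add0r; last by move=> e _; rewrite pd_left_l mulr0.
  by apply: eq_bigr => e _; rewrite christoffel_rrr // pd_right_l.
rewrite (sum_split s) -/L -/D /warp_laplacian mulrDr [RHS]addrC; congr (_ + _).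
  transitivity (\sum_(i < n1) (F1 (lp x) ^+ 2)^-1 * \sum_c X (rp x) c * pd c l (rp x)).
    apply: eq_bigr => i _; rewrite (sum_split s) -/L -/D.
    rewrite [X in _ + X]big1 ?addr0; last by move=> c _; rewrite (wc_inv_lr W) // mul0r.
    rewrite -[RHS]mul1r -[X in X * _](mulVmx_diag i (cm_unit (wc_left_metric W) Uy)).
    rewrite mulr_suml.
    apply: eq_bigr => j _; rewrite hl (wc_inv_ll W) // /coupling.
    rewrite (metric_entry_sym (wc_left_metric W) i j Uy) -/(lp x) -/(rp x).
    move: (\sum_c _) (F2 _ ^+ 2) F2n0 => t r r0.
    by field; rewrite gt_eqF // (wc_left_gt0 W).
  by rewrite sumr_const card_ord -[LHS]mulr_natl mulrCA.
rewrite mulr_sumr; apply: eq_bigr => c _; rewrite (sum_split s) -/L -/D.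
rewrite big1 ?add0r; last by move=> i _; rewrite (wc_inv_rl W) // mul0r.
by rewrite mulr_sumr; apply: eq_bigr => d _; rewrite hr (wc_inv_rr W) // mulrA.
Qed.

Lemma inner_log_warp (f : 'rV[R]_n -> R) x : U x ->
  \sum_i \sum_j invmx (G x) i j * (pd i (l \o rp) x * pd j f x) =
  (F1 (lp x) ^+ 2)^-1 * \sum_c X (rp x) c * pd (D c) f x.
Proof.
move=> Ux; have Uz := wc_right_dom W Ux.
rewrite (sum_split s) -/L -/D big1 ?add0r; last first.
  by move=> i _; apply: big1 => j _; rewrite pd_left_l mul0r mulr0.
transitivity (\sum_d \sum_c (F1 (lp x) ^+ 2)^-1 *
    (invmx (g2 (rp x)) c d * pd d l (rp x) * pd (D c) f x)).
  apply: eq_bigr => d _; rewrite (sum_split s) -/L -/D.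
  rewrite big1 ?add0r; last by move=> i _; rewrite (wc_inv_rl W) // mul0r.
  apply: eq_bigr => c _; rewrite (wc_inv_rr W) // pd_right_l.
  by rewrite (inverse_metric_sym (wc_right_metric W) _ _ Uz) !mulrA.
rewrite exchange_big mulr_sumr /=; apply: eq_bigr => c _.
by rewrite -mulr_sumr -mulr_suml.
Qed.

(** The Hessian of [f] along the left directions exceeds that of its restriction
    to the slice by [g * <grad l, grad f>], and the Ricci tensor falls short of
    that of the factor by [g * laplacian l]. Both corrections are multiples of
    the metric, so the traced soliton equation survives on the slice. *)
Lemma slice_soliton_equation (f : 'rV[R]_n -> R) (S : 'rV[R]_n1 -> 'rV[R]_n)
    (c lambda lap : R) x a b : U x ->
  (forall i (h : R) y, S (h *: delta_mx 0 i + y) = h *: delta_mx 0 (L i) + S y) ->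
  S (lp x) = x -> smooth_on U1 (f \o S) ->
  local_ric G x (L a) (L b) + c * local_hess G f x (L a) (L b)
    + G x (L a) (L b) * lap = lambda * G x (L a) (L b) ->
  local_ric g1 (lp x) a b
    + local_hess g1 (fun y => c * f (S y) - n2%:R * k y) (lp x) a b =
  F2 (rp x) ^+ 2 *
    (lambda + \sum_i \sum_j invmx (G x) i j * local_hess G (l \o rp) x i j - lap
     - c * \sum_i \sum_j invmx (G x) i j * (pd i (l \o rp) x * pd j f x))
    * g1 (lp x) a b
  + n2%:R * (pd a k (lp x) * pd b k (lp x)).
Proof.
move=> Ux transS Sx sfS; have Uy := wc_left_dom W Ux.
have sk : smooth_on U1 k.
  apply: smooth_on_ln (cm_open (wc_left_metric W)) (wc_left_gt0 W) _.
  exact: wc_left_smooth W.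
rewrite (local_hessB (wc_left_metric W) _ _ _ _ sfS sk Uy) laplacian_log_warp //.
rewrite inner_log_warp // local_ric_left // local_hess_left // (wc_ll W).
have -> : local_hess g1 (f \o S) (lp x) a b = pd (L a) (pd (L b) f) x
    - \sum_e christoffel g1 (lp x) a b e * pd (L e) f x.
  rewrite /local_hess !(pd_slice transS) /= Sx; congr (_ - _).
  by apply: eq_bigr => e _; rewrite (pd_slice transS) /= Sx.
rewrite -/(rp x) -/(lp x) /coupling -/L -/D.
have E (ric hk kk hf wl gf v r gab d : R) :
    ric - d * (hk + kk) - gab * v * r * wl + c * (hf + gab * v * r * gf)
      + gab * r * lap = lambda * (gab * r) ->
    ric + (c * hf - d * hk) =
    r * (lambda + v * wl - lap - c * (v * gf)) * gab + d * kk.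
  move=> E; apply/eqP; rewrite -subr_eq0; move/eqP: E; rewrite -subr_eq0 => /eqP E.
  by rewrite -E; apply/eqP; ring.
exact: E.
Qed.

End RicciWarped.

(** * From tensors to components *)

Section ManifoldComponents.
Context {R : realType} {n : nat} {M : smooth_manifold R n}.
Variable g : riemannian_metric M.

Lemma riemannian_chart_metric (i : chart_idx M) : chart_metric (img i) (g i).
Proof.
split; [exact: img_open|exact: gcomp_smooth|exact: gcomp_sym|move=> x ix].
rewrite unitmxE unitfE; apply/det0P => -[u u0 uG].
by have := gcomp_pos g ix u0; rewrite uG mul0mx mxE ltxx.
Qed.

Lemma at_chart_img (p : M) : img (chart_at p) (at_chart p).
Proof. by exists p => //; exact: chart_atP. Qed.

Lemma param_at_chart (p : M) : param (chart_at p) (at_chart p) = p.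
Proof. by apply: coordK; exact: chart_atP. Qed.

Lemma innerE (p : M) (u v : 'rV[R]_n) :
  inner g p u v = \sum_i \sum_j u 0 i * v 0 j * metric_mx g p i j.
Proof.
rewrite /inner !mxE exchange_big /=; apply: eq_bigr => j _.
rewrite !mxE mulr_suml; apply: eq_bigr => i _.
by rewrite mulrAC.
Qed.

(** Raising the index of both differentials uses the inverse metric twice, and
    the inner product cancels one of them. *)
Lemma inner_gradE (f h : M -> R) (p : M) :
  inner g p (grad g f p) (grad g h p) =
  \sum_i \sum_j invmx (metric_mx g p) i j *
    (pd i (local_rep f p) (at_chart p) * pd j (local_rep h p) (at_chart p)).
Proof.
have gG := riemannian_chart_metric (chart_at p); have Ux := at_chart_img p.
pose d (f : M -> R) : 'rV[R]_n := \row_i pd i (local_rep f p) (at_chart p).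
have gradE (e : M -> R) : grad g e p = d e *m invmx (metric_mx g p).
  by apply/rowP => j; rewrite !mxE; apply: eq_bigr => i _; rewrite mxE.
rewrite /inner !gradE trmx_mul trmx_inv (cm_sym gG Ux) mulmxKV ?(cm_unit gG Ux) //.
rewrite mulmxA !mxE exchange_big /=; apply: eq_bigr => j _.
rewrite !mxE mulr_suml; apply: eq_bigr => i _.
by rewrite !mxE; ring.
Qed.

Lemma bilinear_sum_delta (F : 'I_n -> 'I_n -> R) a b :
  \sum_i \sum_j (delta_mx 0 a : 'rV[R]_n) 0 i * (delta_mx 0 b : 'rV[R]_n) 0 j * F i j
  = F a b.
Proof.
rewrite -[RHS](sum_deltal (F ^~ b) a); apply: eq_bigr => i _.
rewrite -(sum_deltal (F i) b) mulr_sumr; apply: eq_bigr => j _.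
by rewrite !mxE !eqxx mulrA.
Qed.

Lemma riem_delta (p : M) a b c d :
  riem g p (delta_mx 0 a) (delta_mx 0 b) (delta_mx 0 c) (delta_mx 0 d) =
  local_riem (g (chart_at p)) (at_chart p) a b c d.
Proof.
pose F := local_riem (g (chart_at p)) (at_chart p).
rewrite -[RHS](bilinear_sum_delta (fun i j => F i j c d)).
apply: eq_bigr => i _; apply: eq_bigr => j _.
rewrite -(bilinear_sum_delta (F i j) c d) mulr_sumr; apply: eq_bigr => k _.
by rewrite mulr_sumr; apply: eq_bigr => l _; rewrite !mulrA.
Qed.

(** Contraction over the first and last arguments: [g(X, W)] contributes the
    dimension, while [g(X, Z) h(Y, W)] and [g(Y, W) h(X, Z)] each return
    [h(Y, Z)]. *)
Lemma soliton_trace (psi : M -> R) (lambda : R) (p : M) a b :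
  gradient_riemann_soliton g psi lambda ->
  let G := g (chart_at p) in let x := at_chart p in
  local_ric G x a b + (n%:R - 2) * local_hess G (local_rep psi p) x a b
    + G x a b * laplacian g psi p = (n%:R - 1) * lambda * G x a b.
Proof.
move=> [_ sol] G x; pose h := local_hess G (local_rep psi p) x.
have gG : chart_metric _ G := riemannian_chart_metric (chart_at p).
have Ux : img (chart_at p) x := at_chart_img p.
have uG := cm_unit gG Ux.
have solE i j : local_riem G x i a b j + G x i j * h a b + G x a b * h i j
    - G x i b * h a j - G x a j * h i b
    = lambda * (G x i j * G x a b - G x i b * G x a j).
  have := sol p (delta_mx 0 i) (delta_mx 0 a) (delta_mx 0 b) (delta_mx 0 j).
  by rewrite riem_delta !innerE /hess !bilinear_sum_delta.
have symV i j : invmx (G x) i j = invmx (G x) j i := inverse_metric_sym gG i j Ux.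
have trGF (F : 'I_n -> R) c : \sum_i \sum_j invmx (G x) i j * (G x i c * F j) = F c.
  rewrite exchange_big /= -[RHS](sum_deltal F c); apply: eq_bigr => j _.
  rewrite -(mulVmx_entry j c uG) mulr_suml; apply: eq_bigr => i _.
  by rewrite symV mulrA.
have trG : \sum_i \sum_j invmx (G x) i j * G x i j = n%:R.
  transitivity (\sum_(i < n) (1 : R)); last by rewrite sumr_const card_ord.
  apply: eq_bigr => i _; rewrite -(mulVmx_diag i uG); apply: eq_bigr => j _.
  by rewrite (metric_entry_sym gG i j Ux).
have trGF' (F : 'I_n -> R) c : \sum_i \sum_j invmx (G x) i j * (G x c j * F i) = F c.
  rewrite exchange_big /= -[RHS](trGF F c); apply: eq_bigr => i _.
  by apply: eq_bigr => j _; rewrite symV (metric_entry_sym gG i c Ux).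
have lhsE : \sum_i \sum_j invmx (G x) i j *
    (local_riem G x i a b j + G x i j * h a b + G x a b * h i j
     - G x i b * h a j - G x a j * h i b) =
  local_ric G x a b + n%:R * h a b + G x a b * laplacian g psi p - h a b - h a b.
  rewrite -[X in _ - X](trGF' (h^~ b)) -[X in _ - X - _](trGF (h a)) -trG.
  rewrite /laplacian mulr_suml mulr_sumr.
  rewrite -!big_split -!sumrB /=; apply: eq_bigr => i _.
  rewrite mulr_suml mulr_sumr -!big_split -!sumrB /=; apply: eq_bigr => j _.
  have E (v r gij hab gab hij gib haj gaj hib : R) :
    v * (r + gij * hab + gab * hij - gib * haj - gaj * hib) =
    v * r + v * gij * hab + gab * (v * hij) - v * (gib * haj) - v * (gaj * hib).
    by ring.
  exact: E.
have rhsE : \sum_i \sum_j invmx (G x) i j *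
    (lambda * (G x i j * G x a b - G x i b * G x a j)) =
  lambda * (n%:R * G x a b - G x a b).
  rewrite -[X in _ - X](trGF (G x a)) -trG mulr_suml -sumrB mulr_sumr.
  apply: eq_bigr => i _; rewrite mulr_suml -sumrB mulr_sumr.
  apply: eq_bigr => j _.
  have E (v gij gab gib gaj : R) : v * (lambda * (gij * gab - gib * gaj)) =
    lambda * (v * gij * gab - v * (gib * gaj)) by ring.
  exact: E.
have : local_ric G x a b + n%:R * h a b + G x a b * laplacian g psi p - h a b - h a b
    = lambda * (n%:R * G x a b - G x a b).
  rewrite -lhsE -rhsE; apply: eq_bigr => i _; apply: eq_bigr => j _.
  by rewrite solE.
have E (d r hab gab lap : R) : r + d * hab + gab * lap - hab - hab =
    lambda * (d * gab - gab) ->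
    r + (d - 2) * hab + gab * lap = (d - 1) * lambda * gab.
  move=> tr; transitivity (lambda * (d * gab - gab)); last by ring.
  by rewrite -tr; ring.
exact: E.
Qed.

(** Both sides of the soliton equation are bilinear in the tangent vectors, so
    it suffices to compare components in the coordinate frame. *)
Lemma eta_ricci_soliton_components (phi k lambda mu : M -> R) :
  smooth_fun phi ->
  (forall p a b, local_ric (g (chart_at p)) (at_chart p) a b
     + local_hess (g (chart_at p)) (local_rep phi p) (at_chart p) a b =
     lambda p * metric_mx g p a b
     + mu p * (pd a (local_rep k p) (at_chart p) * pd b (local_rep k p) (at_chart p))) ->
  gradient_almost_eta_ricci_soliton g phi lambda mu (differential k).
Proof.
move=> sphi E; split=> // p u v; rewrite innerE /ric /hess -big_split /=.
rewrite /differential !mulr_suml !mulr_sumr -big_split /=; apply: eq_bigr => i _.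
rewrite !mulr_sumr -!big_split /=; apply: eq_bigr => j _.
by rewrite -mulrDr E; ring.
Qed.

End ManifoldComponents.

(** * Product charts of a doubly warped product *)

Section ProductCharts.
Context {R : realType} {n1 n2 : nat}.

Definition product_splitting : @coord_splitting R (n1 + n2) n1 n2.
Proof.
apply: (@CoordSplitting _ _ _ _ (lshift n2) (@rshift n1 n2)
  (@lsubmx R 1 n1 n2) (@rsubmx R 1 n1 n2)).
- by move=> F; rewrite big_split_ord.
- by move=> i; apply/rowP => j; rewrite !mxE eq_lshift.
- by move=> i; apply/rowP => j; rewrite !mxE eq_lrshift.
- by move=> i; apply/rowP => j; rewrite !mxE eq_rlshift.
- by move=> i; apply/rowP => j; rewrite !mxE eq_rshift.
Defined.

Lemma left_slice_translate (z : 'rV[R]_n2) i (h : R) (y : 'rV[R]_n1) :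
  row_mx (h *: delta_mx 0 i + y) z = h *: delta_mx 0 (lshift n2 i) + row_mx y z.
Proof.
apply/rowP => j; rewrite [RHS]mxE; case: (split_ordP j) => j' ->.
  by rewrite !row_mxEl !mxE eq_lshift.
by rewrite !row_mxEr !mxE eq_rlshift mulr0 add0r.
Qed.

Lemma right_slice_translate (y : 'rV[R]_n1) i (h : R) (z : 'rV[R]_n2) :
  row_mx y (h *: delta_mx 0 i + z) = h *: delta_mx 0 (rshift n1 i) + row_mx y z.
Proof.
apply/rowP => j; rewrite [RHS]mxE; case: (split_ordP j) => j' ->.
  by rewrite !row_mxEl !mxE eq_lrshift mulr0 add0r.
by rewrite !row_mxEr !mxE eq_rshift.
Qed.

Lemma differentiable_mulmxr (m p : nat) (A : 'M[R]_(m, p)) (y : 'rV[R]_m) :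
  differentiable (mulmxr A) y.
Proof.
apply: linear_differentiable => {}y; apply: continuous_rV => j.
apply: differentiable_continuous.
rewrite (_ : (fun x => _) = \sum_i (fun x : 'rV[R]_m => x 0 i * A i j)); last first.
  by apply/funext => x; rewrite fct_sumE !mxE.
apply: differentiable_sum => i; apply: differentiableM; last exact: differentiable_cst.
exact: differentiable_coord.
Qed.

Lemma differentiable_left_slice (z : 'rV[R]_n2) (y : 'rV[R]_n1) :
  differentiable (row_mx ^~ z) y.
Proof.
rewrite (_ : row_mx ^~ z = mulmxr (row_mx 1%:M 0) \+ cst (row_mx 0 z)).
  apply: differentiableD; [exact: differentiable_mulmxr|exact: differentiable_cst].
apply/funext => x /=.
by rewrite mul_mx_row mulmx1 mulmx0 add_row_mx addr0 add0r.
Qed.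

Lemma differentiable_right_slice (y : 'rV[R]_n1) (z : 'rV[R]_n2) :
  differentiable (row_mx y) z.
Proof.
rewrite (_ : row_mx y = mulmxr (row_mx 0 1%:M) \+ cst (row_mx y 0)).
  apply: differentiableD; [exact: differentiable_mulmxr|exact: differentiable_cst].
apply/funext => x /=.
by rewrite mul_mx_row mulmx1 mulmx0 add_row_mx addr0 add0r.
Qed.

End ProductCharts.

Section DoublyWarped.
Context {R : realType} {m1 m2 : nat}.
Context {M1 : smooth_manifold R m1} {M2 : smooth_manifold R m2}.
Variables (g1 : riemannian_metric M1) (g2 : riemannian_metric M2).
Variables (f1 : pos_smooth_fun M1) (f2 : pos_smooth_fun M2).

Let M := prod_manifold M1 M2.
Let g := dwp_metric g1 g2 f1 f2.

(** A block diagonal metric is inverted block by block. *)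
Lemma dwp_warped_chart (i : chart_idx M) :
  warped_chart product_splitting (img i) (g i)
    (img i.1) (g1 i.1) (f1 \o param i.1) (img i.2) (g2 i.2) (f2 \o param i.2).
Proof.
have imgE : img i = (lsubmx @^-1` img i.1) `&` (rsubmx @^-1` img i.2).
  exact: prod_img.
have invE x : img i x -> invmx (g i x) =
    block_mx ((f2 (param i.2 (rsubmx x)) ^+ 2)^-1 *: invmx (g1 i.1 (lsubmx x))) 0
      0 ((f1 (param i.1 (lsubmx x)) ^+ 2)^-1 *: invmx (g2 i.2 (rsubmx x))).
  move=> ix; have uG := cm_unit (riemannian_chart_metric g i) ix.
  rewrite [g i x]/(dwp_comp _ _ _ _ _ _) invmx_block_diag //.
  move: ix; rewrite imgE => -[/= i1x i2x].
  have u1 := cm_unit (riemannian_chart_metric g1 i.1) i1x.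
  have u2 := cm_unit (riemannian_chart_metric g2 i.2) i2x.
  by rewrite !invmxZ // unitmxZ // unitfE expf_neq0 // gt_eqF // psf_gt0.
split; try exact: riemannian_chart_metric.
- by move=> x; rewrite imgE => -[].
- by move=> x; rewrite imgE => -[].
- by move=> y; exact: psf_gt0.
- by move=> z; exact: psf_gt0.
- exact: psf_smooth.
- exact: psf_smooth.
- by move=> x a b; rewrite /= /dwp_comp block_mxEul mxE mulrC.
- by move=> x a b; rewrite /= /dwp_comp block_mxEdr mxE mulrC.
- by move=> x a b; rewrite /= /dwp_comp block_mxEur mxE.
- by move=> x a b; rewrite /= /dwp_comp block_mxEdl mxE.
- by move=> x a b ix; rewrite invE // block_mxEul mxE.
- by move=> x a b ix; rewrite invE // block_mxEdr mxE.
- by move=> x a b ix; rewrite invE // block_mxEur mxE.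
- by move=> x a b ix; rewrite invE // block_mxEdl mxE.
Qed.

(** In a product chart, restricting to a slice freezes the coordinates of the
    fixed point in its distinguished chart. *)
Lemma left_slice_chart (psi : M -> R) p2 i :
  (fun y => psi (param i y, p2)) =
  (psi \o param ((i, chart_at p2) : chart_idx M)) \o row_mx^~ (at_chart p2).
Proof.
by apply/funext => y; rewrite /= /prod_param /= row_mxKl row_mxKr param_at_chart.
Qed.

Lemma right_slice_chart (psi : M -> R) p1 i :
  (fun z => psi (p1, param i z)) =
  (psi \o param ((chart_at p1, i) : chart_idx M)) \o row_mx (at_chart p1).
Proof.
by apply/funext => z; rewrite /= /prod_param /= row_mxKl row_mxKr param_at_chart.
Qed.

Lemma smooth_left_slice (psi : M -> R) p2 i :
  smooth_fun psi -> smooth_on (img i) (fun y => psi (param i y, p2)).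
Proof.
move=> spsi; pose j : chart_idx M := (i, chart_at p2); pose z := at_chart p2.
have sj : smooth_on ((row_mx^~ z) @^-1` img j) ((psi \o param j) \o row_mx^~ z).
  apply: smooth_on_slice (spsi j); first exact: left_slice_translate.
  exact: differentiable_left_slice.
rewrite left_slice_chart; apply: smooth_on_sub sj => y iy.
by rewrite /= [img _]prod_img /= row_mxKl row_mxKr; split=> //; exact: at_chart_img.
Qed.

Lemma smooth_right_slice (psi : M -> R) p1 i :
  smooth_fun psi -> smooth_on (img i) (fun z => psi (p1, param i z)).
Proof.
move=> spsi; pose j : chart_idx M := (chart_at p1, i); pose y := at_chart p1.
have sj : smooth_on ((row_mx y) @^-1` img j) ((psi \o param j) \o row_mx y).
  apply: smooth_on_slice (spsi j); first exact: right_slice_translate.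
  exact: differentiable_right_slice.
rewrite right_slice_chart; apply: smooth_on_sub sj => z iz.
by rewrite /= [img _]prod_img /= row_mxKl row_mxKr; split=> //; exact: at_chart_img.
Qed.

End DoublyWarped.

Lemma smooth_fun_log_comb (R : realType) (n : nat) (M : smooth_manifold R n)
    (f : pos_smooth_fun M) (psi : M -> R) (c d : R) :
  (forall i, smooth_on (img i) (psi \o param i)) ->
  smooth_fun (fun p => c * psi p - d * ln (f p)).
Proof.
move=> spsi i; have oU : open (img i) by exact: img_open.
have -> : (fun p => c * psi p - d * ln (f p)) \o param i =
    (fun y => c * (psi \o param i) y + (- d) * (@ln R \o (f \o param i)) y).
  by apply/funext => y; rewrite /= mulNr.
apply: smooth_onD => //; apply: smooth_onM => //; try exact: smooth_on_cst.
apply: smooth_on_ln => //; last exact: psf_smooth.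
by move=> y; exact: psf_gt0.
Qed.

(** * Solitons on the factors *)

Theorem theorem3p10 (R : realType) (m1 m2 : nat)
    (M1 : smooth_manifold R m1) (M2 : smooth_manifold R m2)
    (g1 : riemannian_metric M1) (g2 : riemannian_metric M2)
    (f1 : pos_smooth_fun M1) (f2 : pos_smooth_fun M2)
    (psi : prod_manifold M1 M2 -> R) (lambda : R) :
  let m := (m1 + m2)%N in
  let g := dwp_metric g1 g2 f1 f2 in
  let k (p1 : M1) := ln (f1 p1) in
  let l (p2 : M2) := ln (f2 p2) in
  let kM (p : prod_manifold M1 M2) := k p.1 in
  let lM (p : prod_manifold M1 M2) := l p.2 in
  gradient_riemann_soliton g psi lambda ->
  (forall p2 : M2,
    gradient_almost_eta_ricci_soliton g1
      (fun p1 => (m%:R - 2) * psi (p1, p2) - m2%:R * k p1)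
      (fun p1 => let p := (p1, p2) in
        f2 p2 ^+ 2 *
        ((m%:R - 1) * lambda + laplacian g lM p - laplacian g psi p
         - (m%:R - 2) * inner g p (grad g lM p) (grad g psi p)))
      (fun=> m2%:R)
      (differential k)) /\
  (forall p1 : M1,
    gradient_almost_eta_ricci_soliton g2
      (fun p2 => (m%:R - 2) * psi (p1, p2) - m1%:R * l p2)
      (fun p2 => let p := (p1, p2) in
        f1 p1 ^+ 2 *
        ((m%:R - 1) * lambda + laplacian g kM p - laplacian g psi p
         - (m%:R - 2) * inner g p (grad g kM p) (grad g psi p)))
      (fun=> m1%:R)
      (differential l)).
Proof.
move=> m g k l kM lM sol; have spsi := sol.1; split=> [p2|p1].
  apply: eta_ricci_soliton_components.
    by apply: smooth_fun_log_comb => i; exact: smooth_left_slice.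
  move=> p1 a b; pose p : prod_manifold M1 M2 := (p1, p2).
  have W := dwp_warped_chart g1 g2 f1 f2 (chart_at p).
  have lpx : left_proj product_splitting (at_chart p) = at_chart p1 := row_mxKl _ _.
  have rpx : right_proj product_splitting (at_chart p) = at_chart p2 := row_mxKr _ _.
  have Sx : row_mx (left_proj product_splitting (at_chart p)) (at_chart p2) =
      at_chart p by rewrite lpx.
  have sS := smooth_left_slice p2 (chart_at p1) spsi.
  rewrite left_slice_chart in sS.
  have phiE : local_rep (fun q => (m%:R - 2) * psi (q, p2) - m2%:R * k q) p1 =
      fun y => (m%:R - 2) * local_rep psi p (row_mx y (at_chart p2))
        - m2%:R * (@ln R \o (f1 \o param (chart_at p1))) y.
    apply/funext => y; rewrite /local_rep /= /prod_param /= row_mxKl row_mxKr.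
    by rewrite param_at_chart.
  have f2E : (f2 \o param (chart_at p).2) (at_chart p2) = f2 p2.
    by rewrite /= param_at_chart.
  have := slice_soliton_equation W (at_chart_img p) (left_slice_translate (at_chart p2))
    Sx sS (soliton_trace p (lshift m2 a) (lshift m2 b) sol).
  cbv beta zeta; rewrite phiE inner_gradE lpx rpx f2E.
  exact.
apply: eta_ricci_soliton_components.
  by apply: smooth_fun_log_comb => i; exact: smooth_right_slice.
move=> p2 a b; pose p : prod_manifold M1 M2 := (p1, p2).
pose s : coord_splitting _ _ _ := swap_splitting (@product_splitting R m1 m2).
have W := swap_warped_chart (dwp_warped_chart g1 g2 f1 f2 (chart_at p)).
have lpx : left_proj s (at_chart p) = at_chart p2 := row_mxKr _ _.
have rpx : right_proj s (at_chart p) = at_chart p1 := row_mxKl _ _.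
have Sx : row_mx (at_chart p1) (left_proj s (at_chart p)) = at_chart p.
  by rewrite lpx.
have sS := smooth_right_slice p1 (chart_at p2) spsi.
rewrite right_slice_chart in sS.
have phiE : local_rep (fun q => (m%:R - 2) * psi (p1, q) - m1%:R * l q) p2 =
    fun z => (m%:R - 2) * local_rep psi p (row_mx (at_chart p1) z)
      - m1%:R * (@ln R \o (f2 \o param (chart_at p2))) z.
  apply/funext => z; rewrite /local_rep /= /prod_param /= row_mxKl row_mxKr.
  by rewrite param_at_chart.
have f1E : (f1 \o param (chart_at p).1) (at_chart p1) = f1 p1.
  by rewrite /= param_at_chart.
have := slice_soliton_equation W (at_chart_img p) (right_slice_translate (at_chart p1))
  Sx sS (soliton_trace p (rshift m1 a) (rshift m1 b) sol).
cbv beta zeta; rewrite phiE inner_gradE lpx rpx f1E.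
exact.
Qed.
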